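(* Let $k\in\{1,2,3,\dots\}\cup\{\infty\}$, let $E$ be a real locally convex Hausdorff space, and let $f:E\supseteq\operatorname{dom}f\to E$ be a map of class $\mathcal{L}ip^k_{FK}$ which is Colombeau$_0$-tame at $y_0$. Then there is a set $U$ with $y_0\in U\in\tau_{\mathrm{Mac}}E$ such that the restriction $f|_U$ of $f$ to $U\cap\operatorname{dom}f$ is injective and its inverse $(f|_U)^{-1}:E\supseteq f(U\cap\operatorname{dom}f)\to E$ is of class $\mathcal{L}ip^k_{FK}$.
   Context: All spaces are real locally convex Hausdorff topological vector spaces; ''bounded'' means von Neumann bounded. Such a space $E$ is locally complete (Mackey complete) if for every closed absolutely convex bounded set $B\subseteq E$, the linear span of $B$, normed by the Minkowski functional of $B$, is a Banach space. Mackey closure topology: a set $U\subseteq E$ is mopen in $E$ if for every $x\in U$ and every bounded $B\subseteq E$ there is a real $\delta>0$ with $tB\subseteq U-x$ for all $0\le t\le\delta$. The mopen sets form a topology $\tau_{\mathrm{Mac}}E$ on $E$, which contains the locally convex topology of $E$. Class $\mathcal{L}ip^{k}_{FK}$ ($k\in\{0,1,2,\dots\}\cup\{\infty\}$): a curve $c:\mathbb{R}\to E$ is $\mathcal{L}ip^0$ if for every bounded $J\subseteq\mathbb{R}$ the set $\{(c(t)-c(s))/(t-s): s\neq t,\ s,t\in J\}$ is bounded in $E$; it is $\mathcal{L}ip^k$ for finite $k$ if it has derivatives up to order $k$ and the $k$-th derivative is $\mathcal{L}ip^0$; it is $\mathcal{L}ip^\infty$ if it is $\mathcal{L}ip^k$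 for all finite $k$ (equivalently, smooth). A map $f:E\supseteq\operatorname{dom}f\to F$ is of class $\mathcal{L}ip^k_{FK}$ if $E$ and $F$ are bornological and locally complete, $\operatorname{dom}f\in\tau_{\mathrm{Mac}}E$, and $f\circ c:\mathbb{R}\to F$ is $\mathcal{L}ip^k$ for every smooth curve $c:\mathbb{R}\to E$ with values in $\operatorname{dom} f$ (equivalently, for every $\mathcal{L}ip^k$ curve with values in $\operatorname{dom}f$). Bornological generator: a set $\mathcal{B}$ of nonempty bounded, closed, absolutely convex subsets of $E$ is a bornological generator for $E$ if for all $A,B\in\mathcal{B}$ there is $C\in\mathcal{B}$ with $A\cup B\subseteq C$, and for every bounded $A\subseteq E$ there are a real $t>0$ and $B\in\mathcal{B}$ with $A\subseteq tB$. For $B\in\mathcal{B}$, let $E_B=\{tv:t>0,\ v\in B\}$ be the linear span of $B$. Gateaux differentiable: $f:E\supseteq\operatorname{dom}f\to E$ is Gateaux differentiable if for every $x\in\operatorname{dom}f$ and $v\in E$ one has $x+tv\in\operatorname{dom}f$ for all sufficiently small real $t$, the limit $f'(x)v=\lim_{t\to0}t^{-1}(f(x+tv)-f(x))$ exists in $E$, and $f'(x):E\to E$ is a continuous linear map. $\mathrm{Colo}_A(f,y_0,\varepsilon,\mathcal{B})$ means: $E$ is bornological and locally complete, $f:E\supseteq\operatorname{dom}f\to E$ is Gateaux differentiable, $\varepsilon$ is a positive real number, $\mathcal{B}$ is a bornological generator for $E$, and for every $B\in\mathcal{B}$ and every $v\in B$, putting $y_1=y_0+2v$, one has $y_1\in\operatorname{dom}f$,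 $y_1\in E_B$, and $(f'(y_1)-f'(y_0))(B)\subseteq\varepsilon\, f'(y_0)(B)$. $\mathrm{Colo}_0(f,y_0,\varepsilon,\mathcal{B})$ means: $\mathrm{Colo}_A(f,y_0,\varepsilon,\mathcal{B})$ holds and $f'(y_0):E\to E$ is a linear homeomorphism. Colombeau$_0$-tame: $f$ is Colombeau$_0$-tame at $y_0\in E$ if for every $V$ open in the locally convex topology of $E$ with $y_0\in V$ there is some $\mathcal{B}$ such that $\mathrm{Colo}_0(f|_V,y_0,\frac12,\mathcal{B})$ holds, where $f|_V$ is the restriction of $f$ to $V\cap\operatorname{dom}f$. *)

(* Defs.v *)
From HB Require Import structures.
From mathcomp Require Export all_boot all_order all_algebra.
From mathcomp Require Export all_classical all_reals topology tvs normedtype.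

Set Implicit Arguments.
Unset Strict Implicit.
Unset Printing Implicit Defensive.

Export numFieldNormedType.Exports.
Import Order.TTheory GRing.Theory Num.Theory.

Local Open Scope classical_set_scope.
Local Open Scope ring_scope.

(* A real locally convex Hausdorff space is [E : tvsType R], with [R : realType],
   together with a proof of [hausdorff_space E]; [tvsType] includes local
   convexity.
   A partial map [f : E ⊇ dom f -> F] is given by a set [D : set E] and a total
   function [f : E -> F] whose values outside of [D] are irrelevant.  Its
   restriction to [U] is [f] with the domain [U `&` D]. *)

Section LocallyConvex.
Variables (R : realType) (E : tvsType R).
Implicit Types (A B U V : set E).

Definition absorbs U A := exists2 r : R, 0 < r &
  forall s : R, r <= `|s| -> A `<=` [set s *: u | u in U].

Definition vbounded A := forall U, nbhs 0 U -> absorbs U A.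

Definition absolutely_convex A := forall (a b : R) (x y : E),
  `|a| + `|b| <= 1 -> A x -> A y -> A (a *: x + b *: y).

Definition bornological := forall U,
  absolutely_convex U -> (forall A, vbounded A -> absorbs U A) -> nbhs 0 U.

Definition linear_span A : set E := [set x | forall V : set E,
  V 0 -> (forall (a : R) u v, V u -> V v -> V (a *: u + v)) -> A `<=` V -> V x].

Definition minkowski A (x : E) : R :=
  inf [set t : R | 0 < t /\ [set t *: a | a in A] x].

(* [linear_span A], normed by [minkowski A], is a Banach space: it is the
   isometric image of a complete normed space, [minkowski A] giving the norm. *)
Definition banach_span A :=
  exists (X : completeNormedModType R) (i : {linear X -> E}),
    [/\ injective i, range i = linear_span A &
        forall x : X, `|x| = minkowski A (i x)].

Definition locally_complete := forall B,
  closed B -> absolutely_convex B -> vbounded B -> banach_span B.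

(* Membership in the Mackey closure topology of [E]. *)
Definition mopen U := forall x B, U x -> vbounded B ->
  exists2 delta : R, 0 < delta &
    forall t : R, 0 <= t <= delta -> forall b, B b -> U (x + t *: b).

Definition bornological_generator (BB : set (set E)) :=
  [/\ forall B, BB B -> [/\ B !=set0, vbounded B, closed B & absolutely_convex B],
      forall A B, BB A -> BB B -> exists2 C, BB C & A `|` B `<=` C &
      forall A, vbounded A -> exists (t : R) (B : set E),
        [/\ 0 < t, BB B & A `<=` [set t *: b | b in B]]].

(* The linear span of [B] for nonempty absolutely convex [B]. *)
Definition cone_span B : set E :=
  [set x | exists (t : R) (v : E), [/\ 0 < t, B v & x = t *: v]].

End LocallyConvex.

Arguments bornological {R} E.
Arguments locally_complete {R} E.

Section Limits.
Variables (R : realType) (E : tvsType R).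
Implicit Types (F : set_system E).

(* A [tvsType] is not a [pnbhsType], so the library's [lim] and [cvg] do not
   apply to it; [tvs_lim F] is unique when [E] is Hausdorff, and [0] if [F] does
   not converge. *)
Definition tvs_cvg F := exists l : E, F --> l.

Definition tvs_lim F : E := xget 0 [set l : E | F --> l].

End Limits.

(* The library's derivatives require normed spaces. *)

Section Curves.
Variables (R : realType) (E : tvsType R).
Implicit Types (c : R -> E) (n : nat).

Definition curve_quotient c (t h : R) : E := h^-1 *: (c (h + t) - c t).

Definition curve_derivable c t := tvs_cvg (curve_quotient c t @ 0^').

Definition curve_derive c (t : R) : E := tvs_lim (curve_quotient c t @ 0^').

Definition curve_deriven n c : R -> E := iter n curve_derive c.

Definition n_derivable n c :=
  forall j, (j < n)%N -> forall t, curve_derivable (curve_deriven j c) t.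

Definition smooth_curve c := forall n, n_derivable n c.

Definition lip0_curve c := forall J : set R, bounded_set J ->
  vbounded [set x : E | exists t s,
    [/\ J t, J s, s != t & x = (t - s)^-1 *: (c t - c s)]].

Definition lipn_curve n c := n_derivable n c /\ lip0_curve (curve_deriven n c).

End Curves.

(* {0, 1, 2, ...} together with infinity *)
Variant lip_order := FiniteOrder of nat | InfiniteOrder.

Definition lip_curve (R : realType) (E : tvsType R) (k : lip_order) (c : R -> E) :=
  match k with
  | FiniteOrder n => lipn_curve n c
  | InfiniteOrder => forall n, lipn_curve n c
  end.

Definition lipFK (R : realType) (E F : tvsType R) (k : lip_order)
    (D : set E) (f : E -> F) :=
  [/\ bornological E /\ locally_complete E,
      bornological F /\ locally_complete F,
      mopen D &
      forall c : R -> E, smooth_curve c -> (forall t, D (c t)) ->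
        lip_curve k (f \o c)].

Section Tame.
Variables (R : realType) (E : tvsType R).
Implicit Types (D : set E) (f : E -> E).

Definition gateaux_quotient f (x v : E) (t : R) : E :=
  t^-1 *: (f (x + t *: v) - f x).

(* [gateaux_derive f x v] is [f'(x) v]. *)
Definition gateaux_derive f (x v : E) : E := tvs_lim (gateaux_quotient f x v @ 0^').

Definition gateaux_differentiable D f := forall x, D x ->
  [/\ forall v, \forall t \near (0 : R), D (x + t *: v),
      forall v, tvs_cvg (gateaux_quotient f x v @ 0^'),
      linear (gateaux_derive f x) &
      continuous (gateaux_derive f x)].

Definition coloA D f (y0 : E) (eps : R) (BB : set (set E)) :=
  [/\ bornological E /\ locally_complete E,
      gateaux_differentiable D f,
      0 < eps,
      bornological_generator BB &
      forall B v, BB B -> B v -> let y1 := y0 + 2 *: v in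
        [/\ D y1, cone_span B y1 &
          [set gateaux_derive f y1 w - gateaux_derive f y0 w | w in B] `<=`
          [set eps *: gateaux_derive f y0 w | w in B]]].

Definition linear_homeomorphism (L : E -> E) :=
  [/\ linear L, continuous L &
      exists M : E -> E, [/\ continuous M, cancel L M & cancel M L]].

Definition colo0 D f y0 eps BB :=
  coloA D f y0 eps BB /\ linear_homeomorphism (gateaux_derive f y0).

Definition colombeau0_tame D f (y0 : E) := forall V : set E, open V -> V y0 ->
  exists BB : set (set E), colo0 (V `&` D) f y0 2^-1 BB.

End Tame.

(* Main.v *)
From HB Require Import structures.
Require Import Defs.
From mathcomp Require Import ring lra.
From mathcomp Require Import interval_inference convex sequences derive realfun exp.
Import Order.TTheory GRing.Theory Num.Theory.
Local Open Scope classical_set_scope.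
Local Open Scope ring_scope.

(** An inverse function theorem for maps that are Lip^k along smooth curves.

    Write [L] for the derivative of [f] at [y0], [M] for its inverse and [g] for
    [M \o f]. On [y0 + 2 B], for [B] in the bornological generator, the derivative of
    [g - id] maps [B] into its half. By the mean value theorem ([mean_value]) [g - id]
    contracts by [1 / 2] with respect to the norm with unit ball [B]
    ([coloA_half_contraction]). Therefore [g] is expanding and Lipschitz for this norm
    ([expanding], [lipschitz]), and as the span of [B] is complete, the equation
    [g y = z] is solved by iteration for [z] close to values of [g] ([solve]). Let [U]
    be the union of the sets [y0 + s B] with [s < 2] ([tame_domain]). The generator
    being directed, any two points of [U], or a point and a bounded set of
    displacements, can be treated with a single [B]. So [f] is injective on [U], and
    both [U] and its image are Mackey open.

    It remains to see that [eta], the composite of the inverse of [f] on [U] with a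
    smooth curve [c] in the image, is Lip^k. In locally complete spaces, a curve is
    Lip^n if and only if its divided differences of orders up to [n + 1] are bounded on
    bounded sets of nodes ([lipn_ddiff_bounded], [ddiff_bounded_lipn]). They are bounded
    for [eta] by induction on the order ([eta_step]), without differentiating [f] or its
    inverse. Indeed, let [p] be the interpolation polynomial of [eta] at all but one of
    the given nodes, and let [t] be the remaining node. Up to the same nonzero factor,
    the next divided difference of [eta] is [eta t - p t], and the difference of the
    divided differences of [f \o eta = c] and [f \o p] is [f (eta t) - f (p t)]. Since
    [g] is expanding, the former is controlled by the latter, and it suffices to bound
    the divided differences of [f \o p] uniformly in the nodes.

    When two nodes are apart, such a bound follows from the lower orders ([ddiff_far]).
    Otherwise one argues by contradiction ([newton_ddiff_near]): node lists that
    violate the bound more and more and shrink to a point fast enough yield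
    polynomial arcs which, after a change of speed, all lie on one smooth curve
    ([special_curve]), and along this curve [f] is Lip^k by hypothesis. *)

Set Implicit Arguments.
Unset Strict Implicit.
Unset Printing Implicit Defensive.

(** * Disks and their dilations *)

Section Disks.
Variables (R : realType) (E : tvsType R).
Implicit Types (A B W : set E) (x y z : E) (a b r s : R).

Definition disk B := absolutely_convex B /\ B 0.

(** [dilation r B x] stands for the inequality [p x <= r] between the Minkowski
    functional [p] of [B] and [r]; the infimum in [p] is thereby avoided, and the
    same calculus serves for bounded disks and for disk neighbourhoods. *)
Definition dilation r B : set E := [set x | exists2 b, B b & x = r *: b].

Lemma dilation1 B x : B x -> dilation 1 B x.
Proof. by move=> Bx; exists x => //; rewrite scale1r. Qed.

Lemma dilation1E B x : dilation 1 B x -> B x.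
Proof. by case=> b Bb ->; rewrite scale1r. Qed.

Lemma dilationS r B A x : B `<=` A -> dilation r B x -> dilation r A x.
Proof. by move=> BA [b Bb ->]; exists b => //; exact: BA. Qed.

Lemma dilationZ r B a x : dilation r B x -> dilation (a * r) B (a *: x).
Proof. by case=> b Bb ->; exists b => //; rewrite scalerA. Qed.

Lemma dilation_dilation r s B x : dilation r (dilation s B) x -> dilation (r * s) B x.
Proof. by case=> _ [b Bb ->] ->; exists b => //; rewrite scalerA. Qed.

Section OneDisk.
Variable B : set E.
Hypothesis diskB : disk B.

Lemma diskZ a x : `|a| <= 1 -> B x -> B (a *: x).
Proof.
case: diskB => + B0 a1 Bx => /(_ a 0 x x).
by rewrite normr0 scale0r !addr0; apply.
Qed.

Lemma dilation0 r : dilation r B 0.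
Proof. by exists 0; [exact: diskB.2|rewrite scaler0]. Qed.

Lemma dilation_le r s x : `|r| <= `|s| -> dilation r B x -> dilation s B x.
Proof.
move=> rs [b Bb ->]; have [s0|s0] := eqVneq s 0.
  have r0 : r = 0 by apply/eqP; rewrite -normr_le0 (le_trans rs)// s0 normr0.
  by exists b => //; rewrite r0 s0.
exists ((r / s) *: b); last by rewrite scalerA mulrC divfK.
by apply: diskZ => //; rewrite normrM normfV ler_pdivrMr ?normr_gt0// mul1r.
Qed.

Lemma dilation_ge0_le r s x : 0 <= r -> r <= s -> dilation r B x -> dilation s B x.
Proof. by move=> r0 rs; apply: dilation_le; rewrite !ger0_norm// (le_trans r0). Qed.

Lemma dilation_abs r x : dilation r B x -> dilation `|r| B x.
Proof. by apply: dilation_le; rewrite normr_id. Qed.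

Lemma dilationN r x : dilation r B x -> dilation r B (- x).
Proof.
by move=> /(dilationZ (-1)); rewrite scaleN1r; apply: dilation_le; rewrite mulN1r normrN.
Qed.

Lemma dilationB_sym r x y : dilation r B (x - y) -> dilation r B (y - x).
Proof. by move=> /dilationN; rewrite opprB. Qed.

Lemma dilationD r s x y : 0 <= r -> 0 <= s ->
  dilation r B x -> dilation s B y -> dilation (r + s) B (x + y).
Proof.
move=> r0 s0 [b Bb ->] [c Bc ->].
have [rs0|rs0] := eqVneq (r + s) 0.
  have [-> ->] : r = 0 /\ s = 0 by split; lra.
  by rewrite !scale0r !addr0; exact: dilation0.
have rsp : 0 < r + s by rewrite lt_def rs0 addr_ge0.
exists ((r / (r + s)) *: b + (s / (r + s)) *: c).
  apply: diskB.1 => //.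
  by rewrite !ger0_norm ?divr_ge0 ?addr_ge0// -mulrDl divff.
by rewrite scalerDr !scalerA ![(r + s) * _]mulrC !divfK.
Qed.

Lemma dilationB r s x y : 0 <= r -> 0 <= s ->
  dilation r B x -> dilation s B y -> dilation (r + s) B (x - y).
Proof. by move=> r0 s0 Bx /dilationN; exact: dilationD. Qed.

Lemma disk_dilation r : disk (dilation r B).
Proof.
split; last exact: dilation0.
move=> a b _ _ ab [x Bx ->] [y By ->]; exists (a *: x + b *: y).
  exact: diskB.1.
by rewrite scalerDr !scalerA ![r * _]mulrC.
Qed.

Lemma dilation_sum I (s : seq I) (P : pred I) (r : I -> R) (x : I -> E) :
  (forall i, P i -> 0 <= r i) -> (forall i, P i -> dilation (r i) B (x i)) ->
  dilation (\sum_(i <- s | P i) r i) B (\sum_(i <- s | P i) x i).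
Proof.
move=> r0 xB; pose K (t : R) y := 0 <= t /\ dilation t B y.
suff : K (\sum_(i <- s | P i) r i) (\sum_(i <- s | P i) x i) by case.
apply: (big_ind2 K) => [|t y u z [t0 By] [u0 Bz]|i Pi]; first by split; [|exact: dilation0].
  by split; [exact: addr_ge0|exact: dilationD].
by split; [exact: r0|exact: xB].
Qed.

End OneDisk.

End Disks.

Section ZeroNeighbourhoods.
Variables (R : realType) (E : tvsType R).
Implicit Types (A B W U : set E) (x y z : E) (a b r s : R).

Definition disk_nbhs W := disk W /\ nbhs 0 W.

(** A convex neighbourhood of [0] becomes balanced when it is intersected with its
    reflection. *)
Lemma nbhs0_disk U : nbhs 0 U -> exists2 W, disk_nbhs W & W `<=` U.
Proof.
move=> nU; have [BB Bconv [Bop Bbase]] := @locally_convex R E.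
have [V [BV V0] VU] := Bbase 0 U nU.
have nV : nbhs 0 V by apply: open_nbhs_nbhs; split => //; exact: Bop.
have convV u v (t : R) : 0 <= t -> t <= 1 -> V u -> V v ->
    V (t *: u + (1 - t) *: v).
  move=> t0 t1 Vu Vv.
  have := Bconv V (mem_set BV) u v (Itv01 t0 t1) (mem_set Vu) (mem_set Vv).
  by rewrite inE.
exists (V `&` -%R @` V); last by move=> x [/VU].
split; last by apply: filterI => //; exact: nbhs0N.
have symW x : (V `&` -%R @` V) x -> (V `&` -%R @` V) (- x).
  move=> [Vx [y Vy yx]]; split; first by rewrite -yx opprK.
  by exists x.
have convW u v (t : R) : 0 <= t -> t <= 1 -> (V `&` -%R @` V) u ->
    (V `&` -%R @` V) v -> (V `&` -%R @` V) (t *: u + (1 - t) *: v).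
  move=> t0 t1 [Vu [u' Vu' uu']] [Vv [v' Vv' vv']]; split; first exact: convV.
  exists (t *: u' + (1 - t) *: v'); first exact: convV.
  by rewrite opprD -!scalerN uu' vv'.
have W0 : (V `&` -%R @` V) 0 by split => //; exists 0; rewrite ?oppr0.
have scW u (t : R) : 0 <= t -> t <= 1 -> (V `&` -%R @` V) u ->
    (V `&` -%R @` V) (t *: u).
  move=> t0 t1 Wu; have := convW _ _ _ t0 t1 Wu W0.
  by rewrite scaler0 addr0.
have scaleW u (t : R) : `|t| <= 1 -> (V `&` -%R @` V) u -> (V `&` -%R @` V) (t *: u).
  move=> t1 Wu; have [t0|t0] := lerP 0 t.
    by apply: scW => //; rewrite -(ger0_norm t0).
  rewrite -[t]opprK scaleNr -scalerN; apply: scW; last exact: symW.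
    by rewrite oppr_ge0 ltW.
  by rewrite -(ltr0_norm t0).
split=> // a b x y ab Wx Wy.
have [n0|n0] := eqVneq (`|a| + `|b|) 0.
  have [-> ->] : a = 0 /\ b = 0.
    by move/eqP: n0; rewrite paddr_eq0// !normr_eq0 => /andP[/eqP-> /eqP->].
  by rewrite !scale0r addr0.
have np : 0 < `|a| + `|b| by rewrite lt_def n0 addr_ge0.
(* a x + b y is a multiple of modulus at most 1 of a convex combination of
   the points +x or -x and +y or -y *)
have -> : a *: x + b *: y = (`|a| + `|b|) *: ((`|a| / (`|a| + `|b|)) *: (Num.sg a *: x)
    + (1 - `|a| / (`|a| + `|b|)) *: (Num.sg b *: y)).
  have -> : 1 - `|a| / (`|a| + `|b|) = `|b| / (`|a| + `|b|) by field.
  rewrite scalerDr !scalerA [in LHS](numEsg a) [in LHS](numEsg b).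
  by congr (_ *: _ + _ *: _); field.
apply: (scaleW); first by rewrite ger0_norm.
by apply: convW; rewrite ?divr_ge0 ?ler_pdivrMr ?mul1r ?lerDl//;
  apply: scaleW => //; rewrite normr_sg; case: (_ != 0); rewrite ?ler01.
Qed.

Lemma disk_nbhs_dilation W r : 0 < r -> disk_nbhs W -> disk_nbhs (dilation r W).
Proof.
move=> r0 [dW nW]; split; first exact: disk_dilation.
have -> : dilation r W = *:%R r @` W.
  by apply/seteqP; split=> x [w Ww] e; exists w.
by apply: nbhs0Z => //; rewrite gt_eqF.
Qed.

Lemma nbhs_disk U x : nbhs x U -> exists2 W, disk_nbhs W &
  forall y, W (y - x) -> U y.
Proof.
move=> /(nbhsB (- x)); rewrite addNr => /nbhs0_disk[W dW WU].
by exists W => // y /WU[u Uu] /eqP; rewrite addrC subr_eq subrK => /eqP <-.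
Qed.

Lemma disk_nbhs_nbhs W x : disk_nbhs W -> nbhs x [set y | W (y - x)].
Proof.
move=> [_ /(nbhsT x)]; apply: filterS => _ [w Ww <-] /=.
by rewrite addrAC subrr add0r.
Qed.

Lemma cvg_diskP (F : set_system E) {FF : Filter F} x :
  (F --> x) <-> (forall W, disk_nbhs W -> F [set y | W (y - x)]).
Proof.
split=> [Fx W /(disk_nbhs_nbhs x)|FW U /nbhs_disk[W dW WU]]; first exact: Fx.
exact: filterS (FW W dW).
Qed.

Lemma closed_diskP B x : closed B ->
  (forall W, disk_nbhs W -> exists2 y, B y & W (y - x)) -> B x.
Proof.
move=> clB Bx; apply: clB => U /nbhs_disk[W dW WU].
by have [y By Wy] := Bx W dW; exists y; split => //; exact: WU.
Qed.

Lemma disk_nbhs_eq0 x : hausdorff_space E ->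
  (forall W, disk_nbhs W -> W x) -> x = 0.
Proof.
move=> hE Wx; apply/esym/hE => A B /nbhs0_disk[W dW WA] nB.
by exists x; split; [apply: WA; exact: Wx|exact: nbhs_singleton].
Qed.

Lemma absorbs_point W x : disk_nbhs W -> exists2 r, 0 < r & dilation r W x.
Proof.
move=> [dW nW]; have /= := @scale_continuous R E (0, x) W.
rewrite scale0r => /(_ nW)[[A1 A2] /= [nA1 nA2] AW].
have [e /= e0 eA] := nA1.
have e2 : 0 < e / 2 by rewrite divr_gt0.
have We : W ((e / 2) *: x).
  apply: (AW (e / 2, x)); split; last exact: nbhs_singleton.
  by apply: eA; rewrite /= sub0r normrN gtr0_norm //; lra.
exists (e / 2)^-1; first by rewrite invr_gt0.
by exists ((e / 2) *: x) => //; rewrite scalerA mulVf ?scale1r// gt_eqF.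
Qed.

Lemma vboundedP A :
  vbounded A <-> (forall W, disk_nbhs W -> exists2 r, 0 < r & A `<=` dilation r W).
Proof.
split=> [bA W [dW nW]|AW U /nbhs0_disk[W dW WU]].
  have [r r0 /(_ r)] := bA W nW; rewrite gtr0_norm// lexx => /(_ isT) Ar.
  by exists r => // x /Ar[w Ww <-]; exists w.
have [r r0 Ar] := AW W dW; exists r => // s rs x /Ar Wx.
have [w Ww ->] := dilation_le dW.1 (eq_ind_r (fun t => t <= _) rs (gtr0_norm r0)) Wx.
by exists w => //; exact: WU.
Qed.

Lemma vboundedS A B : A `<=` B -> vbounded B -> vbounded A.
Proof.
move=> AB /vboundedP bB; apply/vboundedP => W /bB[r r0 Br]; exists r => //.
exact: subset_trans Br.
Qed.

Lemma vboundedU A B : vbounded A -> vbounded B -> vbounded (A `|` B).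
Proof.
move=> /vboundedP bA /vboundedP bB; apply/vboundedP => W dW.
have [r r0 Ar] := bA W dW; have [s s0 Bs] := bB W dW.
exists (r + s); first exact: addr_gt0.
by move=> x [/Ar|/Bs]; apply: dilation_ge0_le; [exact: dW.1| lra|lra|exact: dW.1|lra|lra].
Qed.

Lemma vbounded1 x : vbounded [set x].
Proof.
apply/vboundedP => W dW; have [r r0 Wx] := absorbs_point x dW.
by exists r => // _ ->.
Qed.

Lemma vbounded_dilation r A : vbounded A -> vbounded (dilation r A).
Proof.
move=> /vboundedP bA; apply/vboundedP => W dW; have [s s0 As] := bA W dW.
exists (`|r| * s + 1); first by rewrite ltr_wpDl// mulr_ge0// ltW.
move=> _ [x /As Wx ->]; apply: (dilation_le dW.1) (dilationZ r Wx).
have rs : 0 <= `|r| * s by rewrite mulr_ge0// ltW.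
by rewrite normrM (gtr0_norm s0) [leRHS]ger0_norm ?lerDl// addr_ge0.
Qed.

Lemma vboundedD A B : vbounded A -> vbounded B ->
  vbounded [set z | exists x y, [/\ A x, B y & z = x + y]].
Proof.
move=> /vboundedP bA /vboundedP bB; apply/vboundedP => W dW.
have [r r0 Ar] := bA W dW; have [s s0 Bs] := bB W dW.
exists (r + s); first exact: addr_gt0.
by move=> _ [x [y [/Ar Ax /Bs By ->]]]; apply: (dilationD dW.1) => //; exact: ltW.
Qed.

(** Each neighbourhood of [0] contains some dilation of the bounded set [B]. *)
Lemma dilation_small_eq0 B x : hausdorff_space E -> disk B -> vbounded B ->
  (forall r, 0 < r -> dilation r B x) -> x = 0.
Proof.
move=> hE dB /vboundedP bB Bx; apply: disk_nbhs_eq0 => // W dW.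
have [r r0 Br] := bB W dW.
have ri0 : 0 < r^-1 by rewrite invr_gt0.
have /(dilationS Br) /dilation_dilation := Bx _ ri0.
by rewrite mulVf ?gt_eqF//; exact: dilation1E.
Qed.

Lemma closed_dilation r B : 0 < r -> closed B -> closed (dilation r B).
Proof.
move=> r0 clB v clv.
have Bv : B (r^-1 *: v).
  apply: closed_diskP clB _ => W dW.
  have [u [[b Bb ->] /= [w Ww e]]] := clv _ (disk_nbhs_nbhs v (disk_nbhs_dilation r0 dW)).
  exists b => //; have -> : b - r^-1 *: v = r^-1 *: (r *: b - v).
    by rewrite scalerBr scalerA mulVf ?scale1r// gt_eqF.
  by rewrite e scalerA mulVf ?scale1r// gt_eqF.
by exists (r^-1 *: v) => //; rewrite scalerA divff ?scale1r// gt_eqF.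
Qed.

Lemma vbounded_linear (G : {linear E -> E}) A : continuous G -> vbounded A -> vbounded (G @` A).
Proof.
move=> cG /vboundedP bA; apply/vboundedP => W dW.
have [V dV VW] : exists2 V, disk_nbhs V & V `<=` G @^-1` W.
  by apply/nbhs0_disk/cG; rewrite linear0; exact: dW.2.
have [r r0 Ar] := bA V dV; exists r => // _ [a /Ar[v Vv ->] <-].
by exists (G v); [exact: VW|rewrite linearZ].
Qed.

End ZeroNeighbourhoods.

(** * Derivatives of curves and the mean value theorem *)

Section Derivatives.
Variables (R : realType) (E : tvsType R).
Implicit Types (A B C W U : set E) (c d : R -> E) (l x y z : E) (a b r s t h : R).

Lemma near0_dnbhsP (P : R -> Prop) :
  (\forall h \near 0^', P h) <->
  exists2 e : R, 0 < e & forall h, h != 0 -> `|h| < e -> P h.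
Proof.
split=> [/nbhs_ballP[e /= e0 eP]|[e e0 eP]].
  exists e => // h h0 he; apply: eP => //=.
  by rewrite /ball /= sub0r normrN.
apply/nbhs_ballP; exists e => //= h; rewrite /ball /= sub0r normrN => he h0.
exact: eP.
Qed.

(** The remainder is compared with [h W] instead of being divided by [h], so that
    no case distinction on [h = 0] is needed in the calculus. *)
Definition has_deriv c t l := forall W, disk_nbhs W ->
  exists2 e : R, 0 < e & forall h, `|h| < e ->
    dilation h W (c (t + h) - c t - h *: l).

Lemma quotient_dilation W h x l : h != 0 ->
  W (h^-1 *: x - l) <-> dilation h W (x - h *: l).
Proof.
move=> h0; have e : h^-1 *: x - l = h^-1 *: (x - h *: l).
  by rewrite scalerBr scalerA mulVf// scale1r.
split=> [Wx|[w Ww ew]].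
  by exists (h^-1 *: x - l) => //; rewrite e scalerA divff// scale1r.
by rewrite e ew scalerA mulVf// scale1r.
Qed.

Lemma has_derivP c t l : (curve_quotient c t @ 0^' --> l) <-> has_deriv c t l.
Proof.
rewrite cvg_diskP; split=> cl W dW.
  have /near0_dnbhsP[e e0 eW] := cl W dW; exists e => // h he.
  have [->|h0] := eqVneq h 0; first by rewrite addr0 subrr scale0r subr0; exact: dilation0 dW.1 _.
  by apply/quotient_dilation => //; have := eW h h0 he; rewrite /curve_quotient /= [h + t]addrC.
have [e e0 eW] := cl W dW; apply/near0_dnbhsP; exists e => // h h0 he.
by rewrite /curve_quotient /= [h + t]addrC; apply/quotient_dilation => //; exact: eW.
Qed.

Lemma has_deriv_unique c t l l' : hausdorff_space E ->
  has_deriv c t l -> has_deriv c t l' -> l = l'.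
Proof.
move=> hE cl cl'; apply/eqP; rewrite -subr_eq0; apply/eqP.
apply: disk_nbhs_eq0 => // W dW.
have dW2 : disk_nbhs (dilation 2^-1 W) by apply: disk_nbhs_dilation.
have [e e0 eW] := cl _ dW2; have [e' e0' eW'] := cl' _ dW2.
have m0 : 0 < Num.min e e' by rewrite lt_min e0.
pose h := Num.min e e' / 2; have h0 : 0 < h by rewrite divr_gt0.
have hm : `|h| < Num.min e e' by rewrite gtr0_norm // /h; lra.
move: hm; rewrite lt_min => /andP[he he'].
have := dilationB (dW.1) _ _ (dilation_dilation (eW' h he')) (dilation_dilation (eW h he)).
have h20 : 0 <= h * 2^-1 by apply: mulr_ge0; lra.
move=> /(_ h20 h20) /(dilationZ h^-1).
have -> : h^-1 * (h * 2^-1 + h * 2^-1) = 1 by field; rewrite gt_eqF.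
rewrite opprB [X in _ *: X]addrC addrA subrK -scalerBr scalerA mulVf ?gt_eqF// scale1r.
exact: dilation1E.
Qed.

Lemma has_deriv_derivable c t l : has_deriv c t l -> curve_derivable c t.
Proof. by move=> /has_derivP cl; exists l. Qed.

Lemma has_deriv_curve_derive c t : curve_derivable c t -> has_deriv c t (curve_derive c t).
Proof.
by move=> [l cl]; apply/has_derivP; exact: (@xgetPex _ 0 [set l | _ --> l]) (ex_intro _ l cl).
Qed.

Lemma curve_deriveE c t l : hausdorff_space E -> has_deriv c t l -> curve_derive c t = l.
Proof.
move=> hE cl; apply: (has_deriv_unique hE _ cl).
exact/has_deriv_curve_derive/has_deriv_derivable/cl.
Qed.

Lemma has_deriv_near c d t l e : 0 < e ->
  (forall s, `|s - t| < e -> c s = d s) -> has_deriv d t l -> has_deriv c t l.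
Proof.
move=> e0 cd dl W dW; have [e' e0' eW] := dl W dW.
exists (Num.min e e'); first by rewrite lt_min e0.
move=> h; rewrite lt_min => /andP[he he'].
rewrite !cd; first exact: eW.
- by rewrite subrr normr0.
- by rewrite addrAC subrr add0r.
Qed.

Lemma has_deriv_cst x t : has_deriv (fun=> x) t 0.
Proof.
move=> W dW; exists 1 => // h _; rewrite subrr scaler0 subr0.
exact: dilation0 dW.1 _.
Qed.

Lemma has_derivD c d t l m : has_deriv c t l -> has_deriv d t m ->
  has_deriv (fun s => c s + d s) t (l + m).
Proof.
move=> cl dm W dW.
have dW2 : disk_nbhs (dilation 2^-1 W) by apply: disk_nbhs_dilation.
have [e e0 eW] := cl _ dW2; have [e' e0' eW'] := dm _ dW2.
exists (Num.min e e'); first by rewrite lt_min e0.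
move=> h; rewrite lt_min => /andP[he he'].
have := dilationD (dW.1) _ _ (dilation_abs dW.1 (dilation_dilation (eW h he)))
  (dilation_abs dW.1 (dilation_dilation (eW' h he'))).
move=> /(_ (normr_ge0 _) (normr_ge0 _)).
rewrite !normrM -mulrDr ![`|2^-1|]ger0_norm ?invr_ge0 ?ler0n//.
have -> : c (t + h) - c t - h *: l + (d (t + h) - d t - h *: m) =
  c (t + h) + d (t + h) - (c t + d t) - h *: (l + m).
  by rewrite scalerDr !opprD [LHS]addrACA [X in X + _ = _]addrACA.
apply: (dilation_le dW.1); rewrite normrM normr_id.
by rewrite [`|_ + _|]ger0_norm; lra.
Qed.

Lemma has_derivZ c t l a : has_deriv c t l -> has_deriv (fun s => a *: c s) t (a *: l).
Proof.
move=> cl W dW.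
have [->|a0] := eqVneq a 0.
  exists 1 => // h _; rewrite !scale0r scaler0 !subr0.
  exact: dilation0 dW.1 _.
have ia0 : 0 < `|a|^-1 by rewrite invr_gt0 normr_gt0.
have [e e0 eW] := cl _ (disk_nbhs_dilation ia0 dW).
exists e => // h he.
have := dilationZ a (dilation_dilation (eW h he)).
rewrite !scalerBr !scalerA [h * a]mulrC; apply: (dilation_le dW.1).
by rewrite !normrM normfV normr_id mulrCA divff ?mulr1// normr_eq0.
Qed.

Lemma has_deriv_affine c (sigma tau : R) t l : has_deriv c (sigma * t + tau) l ->
  has_deriv (fun s => c (sigma * s + tau)) t (sigma *: l).
Proof.
move=> cl W dW.
have s1 : 0 < `|sigma| + 1 by rewrite ltr_wpDl.
have is1 : 0 < (`|sigma| + 1)^-1 by rewrite invr_gt0.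
have [e e0 eW] := cl _ (disk_nbhs_dilation is1 dW).
exists (e / (`|sigma| + 1)); first by rewrite divr_gt0.
move=> h; rewrite ltr_pdivlMr// => he.
have : `|sigma * h| < e.
  by apply: le_lt_trans he; rewrite normrM mulrC ler_wpM2l// lerDl.
move=> /eW /dilation_dilation.
have -> : sigma * t + tau + sigma * h = sigma * (t + h) + tau by ring.
rewrite scalerA [h * sigma]mulrC; apply: (dilation_le dW.1).
rewrite !normrM normfV [`| _ + 1|]gtr0_norm// ler_pdivrMr// mulrC.
by rewrite ler_wpM2l// lerDl.
Qed.

Lemma has_deriv_scalar (rho : R -> R) t (rho' : R) x : is_derive t 1 rho rho' ->
  has_deriv (fun s => rho s *: x) t (rho' *: x).
Proof.
move=> [dr er] W dW; have [r r0 Wx] := absorbs_point x dW.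
have ri : 0 < r^-1 by rewrite invr_gt0.
have : (fun h => h^-1 *: ((rho \o shift t) (h *: 1) - rho t)) @ 0^' --> rho'.
  by rewrite -er; apply: dr.
move=> /cvgrPdist_lt /(_ _ ri) /near0_dnbhsP[e e0 eW]; exists e => // h he.
have [->|h0] := eqVneq h 0.
  by rewrite addr0 subrr scale0r subr0; exact: dilation0 dW.1 _.
have := eW h h0 he; rewrite /= /shift /= [h *: 1]mulr1 [h + t]addrC => hr.
rewrite -scalerBl scalerA -scalerBl.
apply: (dilation_le dW.1) (dilationZ _ Wx).
rewrite normrM (gtr0_norm r0) -ler_pdivlMr//.
have -> : rho (t + h) - rho t - h * rho' = h * (h^-1 *: (rho (t + h) - rho t) - rho').
  by rewrite /GRing.scale /=; field.
by rewrite normrM ler_wpM2l // distrC ltW.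
Qed.

Lemma has_deriv_continuous c t l W : has_deriv c t l -> disk_nbhs W ->
  exists2 e : R, 0 < e & forall h, `|h| < e -> W (c (t + h) - c t).
Proof.
move=> cl dW; have [e e0 eW] := cl _ dW; have [r r0 Wl] := absorbs_point l dW.
have m0 : 0 < (1 + r)^-1 by rewrite invr_gt0 addr_gt0.
exists (Num.min e (1 + r)^-1); first by rewrite lt_min e0.
move=> h; rewrite lt_min => /andP[he hm].
apply: dilation1E.
have := dilationD dW.1 _ _ (dilation_abs dW.1 (eW h he)) (dilation_abs dW.1 (dilationZ h Wl)).
rewrite subrK => /(_ (normr_ge0 _) (normr_ge0 _)); apply: (dilation_le dW.1).
rewrite normr1 [leLHS]ger0_norm ?addr_ge0// normrM (gtr0_norm r0).
have -> : `|h| + `|h| * r = `|h| * (1 + r) by ring.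
by rewrite -ler_pdivlMr ?addr_gt0// mul1r ltW.
Qed.

Lemma linear_bundle (M : E -> E) : linear M -> exists M' : {linear E -> E}, M = M'.
Proof.
move=> lM; pose mM := GRing.isLinear.Build R E E _ M lM.
by exists (HB.pack_for {linear E -> E} M mM).
Qed.

Lemma has_deriv_linear (M : E -> E) c t l : linear M -> continuous M ->
  has_deriv c t l -> has_deriv (M \o c) t (M l).
Proof.
move=> /linear_bundle[M' ->] cM cl W dW.
have [V dV VW] : exists2 V, disk_nbhs V & V `<=` M' @^-1` W.
  by apply/nbhs0_disk/cM; rewrite linear0; exact: dW.2.
have [e e0 eV] := cl V dV; exists e => // h he.
have [w Vw ew] := eV h he; exists (M' w); first exact: VW.
by rewrite /= -!linearZ -ew !linearB.
Qed.

Lemma has_deriv_sum n (c : 'I_n -> R -> E) t (l : 'I_n -> E) :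
  (forall i, has_deriv (c i) t (l i)) ->
  has_deriv (fun s => \sum_(i < n) c i s) t (\sum_(i < n) l i).
Proof.
elim: n c l => [|n IH] c l cl.
  rewrite big_ord0; have -> : (fun s => \sum_(i < 0) c i s) = fun=> 0.
    by apply/funext => s; rewrite big_ord0.
  exact: has_deriv_cst.
have -> : (fun s => \sum_(i < n.+1) c i s) =
    fun s => c ord0 s + \sum_(i < n) c (lift ord0 i) s.
  by apply/funext => s; rewrite big_ord_recl.
by rewrite big_ord_recl; apply: has_derivD => //; apply: IH => i.
Qed.

End Derivatives.

Section MeanValue.
Variables (R : realType) (E : tvsType R).
Implicit Types (A B C W U : set E) (c d : R -> E) (l x y z : E) (a b r s t h : R).

Definition convex C := forall x y t, 0 <= t -> t <= 1 -> C x -> C y ->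
  C (t *: x + (1 - t) *: y).

Lemma disk_convex B : disk B -> convex B.
Proof.
move=> dB x y t t0 t1 Bx By; apply: dB.1 => //.
by rewrite !ger0_norm ?subr_ge0// addrC subrK.
Qed.

(** For a fixed disk neighbourhood [W] the points [t] at which the increment
    from [a] is, up to [(t - a) W], a multiple by [t - a] of a point of [C] form
    a set that contains its supremum and, by differentiability, cannot end
    before [b]. *)
Lemma mean_value_approx c a b C W : a < b -> convex C -> disk_nbhs W ->
  (forall t, a <= t <= b -> exists2 l, C l & has_deriv c t l) ->
  exists2 z, C z & dilation (b - a) W (c b - c a - (b - a) *: z).
Proof.
move=> ab cC dW dc.
pose good u v := exists2 z, C z & dilation (v - u) W (c v - c u - (v - u) *: z).
have good_trans u v w : u <= v -> v <= w -> good u v -> good v w -> good u w.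
  move=> uv vw [z1 Cz1 Wz1] [z2 Cz2 Wz2].
  have [uw|uw] := eqVneq (w - u) 0.
    have -> : w = u by lra.
    by exists z1 => //; rewrite !subrr scale0r subr0; exact: dilation0 dW.1 _.
  have wu : 0 < w - u by rewrite lt_def uw; lra.
  exists (((v - u) / (w - u)) *: z1 + (1 - (v - u) / (w - u)) *: z2).
    apply: cC => //; first by rewrite divr_ge0; lra.
    by rewrite ler_pdivrMr// mul1r; lra.
  have vu0 : 0 <= v - u by lra.
  have wv0 : 0 <= w - v by lra.
  have -> : c w - c u - (w - u) *: ((v - u) / (w - u) *: z1 +
      (1 - (v - u) / (w - u)) *: z2) =
      c v - c u - (v - u) *: z1 + (c w - c v - (w - v) *: z2).
    rewrite scalerDr !scalerA.
    have -> : (w - u) * ((v - u) / (w - u)) = v - u by field.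
    have -> : (w - u) * (1 - (v - u) / (w - u)) = w - v by field.
    by rewrite [RHS]addrACA -opprD [c v - _ + _]addrC addrA subrK.
  have -> : w - u = (v - u) + (w - v) by ring.
  by apply: (dilationD dW.1).
pose S := [set t | a <= t <= b /\ good a t].
have Sa : S a.
  split; first by rewrite lexx ltW.
  have [l Cl _] := dc a (introT andP (conj (lexx a) (ltW ab))).
  by exists l => //; rewrite !subrr scale0r subr0; exact: dilation0 dW.1 _.
have ubS : ubound S b by move=> t [/andP[]].
have hS : has_sup S by split; [exists a|exists b].
have sS : a <= sup S <= b.
  by rewrite (sup_ubound hS.2 Sa) /=; apply: ge_sup => //; exists a.
have [l Cl dl] := dc _ sS; have [e e0 eW] := dl W dW.
have good_near h : 0 <= h -> h < e -> good (sup S) (sup S + h).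
  move=> h0 he; exists l => //; rewrite [_ + h - _]addrC addKr.
  by apply: eW; rewrite ger0_norm.
have good_sup : good a (sup S).
  have [t St tS] := sup_adherent e0 hS.
  have tS' := sup_ubound hS.2 St.
  apply: (good_trans _ t) => //; [by case: St => /andP[]|exact: St.2|].
  have te : `|t - sup S| < e by rewrite ler0_norm; lra.
  exists l => //; have := dilationN dW.1 (eW _ te).
  have -> : sup S + (t - sup S) = t by ring.
  have -> : - (c t - c (sup S) - (t - sup S) *: l) = c (sup S) - c t - (sup S - t) *: l.
    by rewrite opprD opprB -!scaleNr !opprB.
  by apply: (dilation_le dW.1); rewrite distrC.
have [sb|sb] := eqVneq (sup S) b; first by rewrite -sb.
have slb : sup S < b by rewrite lt_def eq_sym sb; case/andP: sS.
pose h := Num.min (e / 2) (b - sup S).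
have h0 : 0 < h by rewrite lt_min; apply/andP; split; lra.
have he : h < e by rewrite gt_min; apply/orP; left; lra.
have hb : h <= b - sup S by rewrite ge_min lexx orbT.
have : S (sup S + h).
  split; first by case/andP: sS => ? ?; apply/andP; split; lra.
  apply: good_trans good_sup (good_near _ _ _) => //; first by case/andP: sS.
    by rewrite lerDl ltW.
  exact: ltW.
by move=> /(sup_ubound hS.2); lra.
Qed.

(** The error term of the approximate version is an arbitrary disk neighbourhood,
    and [C] is closed; no linear functionals are involved. *)
Lemma mean_value c a b C : a < b -> closed C -> convex C ->
  (forall t, a <= t <= b -> exists2 l, C l & has_deriv c t l) ->
  C ((b - a)^-1 *: (c b - c a)).
Proof.
move=> ab clC cC dc; apply: closed_diskP => // W dW.
have ba : 0 < b - a by rewrite subr_gt0.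
have [z Cz [w Ww e]] := mean_value_approx ab cC dW dc.
exists z => //; rewrite -[z - _]opprB -scaleN1r.
apply: diskZ => //; [exact: dW.1|by rewrite normrN1|].
have -> : z = (b - a)^-1 *: ((b - a) *: z) by rewrite scalerA mulVf ?gt_eqF// scale1r.
by rewrite -scalerBr e scalerA mulVf ?gt_eqF// scale1r.
Qed.

End MeanValue.

Section Compactness.
Variable R : realType.

(** The Bolzano-Weierstrass theorem, in the form used in proofs by contradiction:
    only one late term of the sequence close to the cluster point is needed. *)
Lemma segment_cluster (a b : R) (x : nat -> R) : (forall n, a <= x n <= b) ->
  exists2 s, a <= s <= b & forall e N, 0 < e -> exists2 n, (N <= n)%N & `|x n - s| < e.
Proof.
move=> xab; have := @segment_compact R a b (x @ \oo) _.
have : (x @ \oo) `[a, b]%classic by exists 0 => // n _; rewrite /= in_itv /= xab.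
move=> /[swap] /[apply] -[s [sab cl]]; exists s; first by move: sab; rewrite /= in_itv.
move=> e N e0.
have /cl : (x @ \oo) (x @` [set n | (N <= n)%N]) by exists N => // n Nn; exists n.
move=> /(_ (ball s e)) /(_ (nbhsx_ballx _ _ e0)) [_ [[n Nn <-] sx]].
by exists n => //; rewrite distrC.
Qed.

End Compactness.

(** * Divided differences *)

Section DividedDifferences.
Variables (R : realType) (E : tvsType R).
Implicit Types (A B T : seq R) (W : set E) (c d : R -> E) (l x y z : E) (a b r s t h : R).

Definition dquot c a t : E := (t - a)^-1 *: (c t - c a).

(** The recursion peels off the first node [a] by replacing [c] with its
    difference quotient at [a]; this is the form in which Newton interpolation
    and the affine and linear invariances are immediate inductions. *)
Fixpoint ddiff c T {struct T} : E :=
  match T with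
  | [::] => 0
  | a :: T' => if T' is [::] then c a else ddiff (dquot c a) T'
  end.

Lemma ddiff_cons c a T : T != [::] -> ddiff c (a :: T) = ddiff (dquot c a) T.
Proof. by case: T. Qed.

Lemma eq_ddiff c d T : {in T, c =1 d} -> ddiff c T = ddiff d T.
Proof.
elim: T c d => // a [|b T] IH c d cd; first by apply: cd; rewrite inE.
rewrite !(ddiff_cons _ a)//; apply: IH => t tT.
by rewrite /dquot !cd // inE ?eqxx// tT orbT.
Qed.

Lemma ddiffD c d T : ddiff (fun t => c t + d t) T = ddiff c T + ddiff d T.
Proof.
elim: T c d => [|a [|b T] IH] c d //=; first by rewrite addr0.
rewrite -IH; apply: (@eq_ddiff _ _ (b :: T)) => t _.
by rewrite /dquot -scalerDr opprD addrACA.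
Qed.

Lemma ddiffZ r c T : ddiff (fun t => r *: c t) T = r *: ddiff c T.
Proof.
elim: T c => [|a [|b T] IH] c //=; first by rewrite scaler0.
rewrite -IH; apply: (@eq_ddiff _ _ (b :: T)) => t _.
by rewrite /dquot -scalerBr !scalerA mulrC.
Qed.

Lemma ddiffB c d T : ddiff (fun t => c t - d t) T = ddiff c T - ddiff d T.
Proof.
rewrite -scaleN1r -ddiffZ -ddiffD; apply: eq_ddiff => t _.
by rewrite scaleN1r.
Qed.

Lemma ddiff_affine c (sigma tau : R) T :
  ddiff (fun s => c (sigma * s + tau)) T =
  sigma ^+ (size T).-1 *: ddiff c [seq sigma * s + tau | s <- T].
Proof.
elim: T c => [|a [|b T] IH] c; first by rewrite scaler0.
  by rewrite /= scale1r.
rewrite ddiff_cons// [map _ _]/= [in RHS]ddiff_cons// [(size _).-1]/= exprS mulrC -scalerA.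
have [->|s0] := eqVneq sigma 0.
  rewrite scale0r scaler0; transitivity (ddiff (fun=> 0 *: (0 : E)) (b :: T)).
    by apply: eq_ddiff => t _; rewrite /dquot !mul0r subrr scaler0 scale0r.
  by rewrite (ddiffZ 0 (fun=> 0)) scale0r.
rewrite -/(map _ (b :: T)) scalerA mulrC -scalerA -(IH (dquot c (sigma * a + tau))) -ddiffZ.
apply: eq_ddiff => t _; rewrite /dquot scalerA; congr (_ *: _).
have -> : sigma * t + tau - (sigma * a + tau) = sigma * (t - a) by ring.
by rewrite invfM mulrA divff// mul1r.
Qed.

Lemma dquot_swap c a b t : a != b -> t != a -> t != b ->
  dquot (dquot c a) b t = dquot (dquot c b) a t.
Proof.
rewrite -(subr_eq0 a) -(subr_eq0 t a) -(subr_eq0 t b) /dquot => ab ta tb.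
have ba : b - a != 0 by rewrite -opprB oppr_eq0.
have -> : c t - c b = (c t - c a) - (c b - c a) by rewrite opprB addrA subrK.
rewrite -[c a - c b]opprB -[a - b]opprB invrN scaleNr scalerN opprK.
move: (c t - c a) (c b - c a) => u v; rewrite !scalerBr !scalerA.
rewrite -addrA -opprD -scalerDl; congr (_ *: _ - _ *: _).
  by rewrite mulrC.
by field; rewrite ta tb ba.
Qed.

(** The basic symmetry, from which invariance under all permutations of the nodes
    follows by moving one node at a time. *)
Lemma ddiff_swap c a b T : uniq [:: a, b & T] -> ddiff c [:: a, b & T] = ddiff c [:: b, a & T].
Proof.
rewrite /= inE negb_or -andbA => /and4P[ab aT bT uT].
case: T aT bT uT => [|t T] aT bT uT /=.
  rewrite /dquot -[b - a]opprB -[c b - c a]opprB scalerN invrN scaleNr opprK //.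
apply: (@eq_ddiff _ _ (t :: T)) => u uT'; apply: dquot_swap => //.
  by apply: contraNneq aT => <-.
by apply: contraNneq bT => <-.
Qed.

Lemma ddiff_move c a A B : uniq (a :: A ++ B) ->
  ddiff c (A ++ a :: B) = ddiff c (a :: A ++ B).
Proof.
elim: A c => // b A IH c uA.
have uA' : uniq (a :: A ++ B).
  by move: uA; rewrite /= inE negb_or -andbA => /and4P[_ -> _ ->].
have nA : A ++ a :: B != [::] by case: (A).
by rewrite [RHS](ddiff_swap _ uA) cat_cons !(ddiff_cons _ b)// IH.
Qed.

Lemma ddiff_perm c A B : uniq A -> perm_eq A B -> ddiff c A = ddiff c B.
Proof.
elim: A c B => [|a A IH] c B uA AB; first by move: AB; rewrite perm_sym => /perm_nilP ->.
have aB : a \in B by rewrite -(perm_mem AB) mem_head.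
have [B1 [B2 eB]] : exists B1 B2, B = B1 ++ a :: B2 by case/splitPr: aB => B1 B2; exists B1, B2.
have pAB : perm_eq A (B1 ++ B2).
  by rewrite -(perm_cons a) (perm_trans AB)// eB perm_catC /= perm_cons perm_catC.
have uB : uniq (a :: B1 ++ B2) by rewrite -(@perm_uniq _ (a :: A))// perm_cons.
rewrite eB ddiff_move//.
have [e|nA] := eqVneq A [::].
  by move: pAB; rewrite e perm_sym => /perm_nilP ->.
have nB : B1 ++ B2 != [::] by apply: contraNneq nA => e; move: pAB; rewrite e => /perm_nilP ->.
by rewrite !ddiff_cons//; apply: IH => //; move: uA => /andP[].
Qed.

(** The nodes in [A] are peeled off by the recursion; without them the formula is a
    partial fraction decomposition of the coefficients. *)
Lemma ddiff_exchange c A a b B : uniq (A ++ [:: b, a & B]) ->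
  ddiff c (A ++ a :: B) - ddiff c (A ++ b :: B) =
  (a - b) *: ddiff c (A ++ [:: b, a & B]).
Proof.
elim: A c => [|e A IH] c.
  rewrite !cat0s /= inE negb_or -andbA => /and4P[ba bB aB uB].
  have ab0 : a - b != 0 by rewrite subr_eq0 eq_sym.
  case: B bB aB uB => [|t B] bB aB uB.
    by rewrite /= /dquot scalerA divff// scale1r.
  rewrite -ddiffB -ddiffZ; apply: (@eq_ddiff _ _ (t :: B)) => u utB.
  have ua : u - a != 0 by rewrite subr_eq0; apply: contraNneq aB => <-.
  have ub : u - b != 0 by rewrite subr_eq0; apply: contraNneq bB => <-.
  rewrite /dquot.
  have -> : c u - c a = (c u - c b) - (c a - c b) by rewrite opprB addrA subrK.
  move: (c u - c b) (c a - c b) => x y; rewrite !scalerBr !scalerA.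
  rewrite addrAC -scalerBl; congr (_ *: _ - _ *: _); field.
    by rewrite ua ub.
  by rewrite ua ab0.
move=> /= /andP[_ uA]; have := IH (dquot c e) uA.
by case: A {IH uA}.
Qed.

Lemma ddiff_cons2 c a b T : uniq [:: a, b & T] ->
  ddiff c [:: a, b & T] = (b - a)^-1 *: (ddiff c (b :: T) - ddiff c (a :: T)).
Proof.
move=> uT; have := @ddiff_exchange c [::] b a T uT => /= ->.
rewrite scalerA mulVf ?scale1r// subr_eq0.
by move: uT; rewrite /= inE negb_or eq_sym => /andP[/andP[]].
Qed.

Lemma ddiff_vanishing c T t : uniq (rcons T t) -> {in T, forall u, c u = 0} ->
  ddiff c (rcons T t) = (\prod_(u <- T) (t - u))^-1 *: c t.
Proof.
elim: T c => [|a T IH] c; first by rewrite /= big_nil invr1 scale1r.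
rewrite rcons_cons /= => /andP[aT uT] cT.
have nT : rcons T t != [::] by case: (T).
have ca : c a = 0 by apply: cT; rewrite mem_head.
have -> : (if rcons T t is [::] then c a else ddiff (dquot c a) (rcons T t)) =
  ddiff (dquot c a) (rcons T t) by case: (rcons T t) nT.
rewrite IH//; last by move=> u uT'; rewrite /dquot ca cT ?subrr ?scaler0// inE uT' orbT.
by rewrite /dquot ca subr0 scalerA big_cons invfM mulrC.
Qed.

Fixpoint newton c T t {struct T} : E :=
  if T is a :: T' then c a + (t - a) *: newton (dquot c a) T' t else 0.

Lemma newton_error c T t : uniq (rcons T t) ->
  c t - newton c T t = (\prod_(u <- T) (t - u)) *: ddiff c (rcons T t).
Proof.
elim: T c => [|a T IH] c; first by rewrite /= subr0 big_nil scale1r.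
rewrite rcons_cons [uniq _]/= => /andP[aT uT].
have nT : rcons T t != [::] by case: (T).
have ta : t - a != 0.
  by rewrite subr_eq0; apply: contraNneq aT => <-; rewrite mem_rcons mem_head.
rewrite ddiff_cons// big_cons -scalerA -IH// scalerBr /= opprD addrA.
by rewrite {2}/dquot scalerA divff// scale1r.
Qed.

Lemma newton_interp c T : uniq T -> {in T, newton c T =1 c}.
Proof.
elim: T c => // a T IH c /= /andP[aT uT] t; rewrite inE => /orP[/eqP->|tT].
  by rewrite subrr scale0r addr0.
have ta : t - a != 0 by rewrite subr_eq0; apply: contraNneq aT => <-.
by rewrite IH// /dquot scalerA divff// scale1r addrC subrK.
Qed.

Lemma newton_expand c T t : newton c T t =
  \sum_(i < size T) (\prod_(u <- take i T) (t - u)) *: ddiff c (take i.+1 T).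
Proof.
elim: T c => [|a T IH] c; first by rewrite big_ord0.
rewrite /= big_ord_recl /= take0 big_nil scale1r; congr (_ + _).
rewrite IH scaler_sumr; apply: eq_bigr => i _.
rewrite /= big_cons scalerA.
by case: T {IH} i => [[]|b T i].
Qed.

Lemma has_deriv_ddiff (c : R -> R -> E) (l : R -> E) s T :
  {in T, forall t, has_deriv (fun u => c u t) s (l t)} ->
  has_deriv (fun u => ddiff (c u) T) s (ddiff l T).
Proof.
elim: T c l => [|a [|b T] IH] c l cl; first exact: has_deriv_cst.
  by apply: cl; rewrite mem_head.
apply: (IH (fun u => dquot (c u) a)) => t tT.
apply: has_derivZ.
have -> : (fun u => c u t - c u a) = (fun u => c u t + (-1) *: c u a).
  by apply/funext => u; rewrite scaleN1r.
rewrite -[- l a]scaleN1r; apply: has_derivD; first by apply: cl; rewrite inE tT orbT.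
by apply: has_derivZ; apply: cl; rewrite mem_head.
Qed.

Lemma prod_nodes_neq0 t T : uniq (t :: T) -> \prod_(u <- T) (t - u) != 0.
Proof.
move=> /= /andP[tT _]; rewrite prodf_seq_neq0; apply/allP => u uT /=.
by rewrite subr_eq0; apply: contraNneq tT => ->.
Qed.

Lemma norm_prod_nodes_le1 (u : R) T : (forall v, v \in T -> `|u - v| <= 1) ->
  `|\prod_(v <- T) (u - v)| <= 1.
Proof.
elim: T => [|v T IH] uT; first by rewrite big_nil normr1.
rewrite big_cons normrM mulr_ile1// ?uT ?mem_head//.
by apply: IH => w wT; apply: uT; rewrite inE wT orbT.
Qed.

(** With the variable centred at [s] the constant coefficient becomes [c a - c s],
    which is small when [a] is close to [s]. *)
Lemma newton_shift (c : R -> E) a T s u :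
  newton c (a :: T) (s + u) = c s +
    \sum_(i < size (a :: T)) (\prod_(v <- take i [seq w - s | w <- a :: T]) (u - v)) *:
      (if nat_of_ord i is 0%N then c a - c s else ddiff c (take i.+1 (a :: T))).
Proof.
rewrite newton_expand /= !big_ord_recl /= !big_nil !scale1r addrA addrCA subrr addr0.
rewrite take0; congr (_ + _); apply: eq_bigr => i _.
rewrite -map_take !big_cons big_map; congr (_ *: _); congr (_ * _); first by ring.
by apply: eq_bigr => v _; ring.
Qed.

(** The two curves agree at the nodes in [T], so that only the node [t] contributes
    to the divided difference of [h \o c - h \o newton c T]. *)
Lemma newton_node_error (h : E -> E) (c : R -> E) t T : uniq (t :: T) ->
  ddiff (h \o c) (t :: T) - ddiff (h \o newton c T) (t :: T) =
  (\prod_(u <- T) (t - u))^-1 *: (h (c t) - h (newton c T t)).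
Proof.
move=> uT; rewrite -ddiffB.
have pT : perm_eq (t :: T) (rcons T t) by rewrite perm_sym perm_rcons.
have uT' : uniq (rcons T t) by rewrite -(perm_uniq pT).
rewrite (ddiff_perm _ uT pT) ddiff_vanishing// => u uTm.
rewrite /= newton_interp ?subrr//.
by move: uT => /= /andP[].
Qed.

(** Every term of the Newton expansion except the first one, [c a], has at least one
    factor [u - v] of size at most [rho], and its other factors are at most [1]. *)
Lemma newton_near_head (c : R -> E) (B : set E) (K rho : R) a T (u : R) : disk B -> 0 <= K -> 0 <= rho -> rho <= 1 ->
  (forall v, v \in a :: T -> `|u - v| <= rho) ->
  (forall i, (i < size T)%N -> dilation K B (ddiff c (take i.+2 (a :: T)))) ->
  dilation ((size T)%:R * (rho * K)) B (newton c (a :: T) u - c a).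
Proof.
move=> dB K0 rho0 rho1 uT cK; rewrite newton_expand [size _]/= big_ord_recl.
rewrite [take _ _]/= big_nil scale1r [take _ _]/= take0 [ddiff _ _]/= addrAC subrr add0r.
have rK : 0 <= rho * K by rewrite mulr_ge0.
have -> : (size T)%:R * (rho * K) = \sum_(i < size T) rho * K.
  by rewrite sumr_const card_ord mulr_natl.
apply: dilation_sum => // i _.
apply: (dilation_le dB) (dilationZ _ (cK i (ltn_ord i))).
rewrite normrM (ger0_norm K0) [leRHS]ger0_norm// ler_wpM2r//.
rewrite lift0 [take _ _]/= big_cons normrM -[leRHS]mulr1 ler_pM ?uT ?mem_head//.
apply: norm_prod_nodes_le1 => v /mem_take vT; apply: le_trans rho1; apply: uT.
by rewrite inE vT orbT.
Qed.

Definition nodes (J : set R) m T := [/\ uniq T, size T = m.+1 & forall t, t \in T -> J t].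

Definition ddiff_bounded (J : set R) m c :=
  vbounded [set x | exists2 T, nodes J m T & x = ddiff c T].

Lemma ddiff_boundedP J m c : ddiff_bounded J m c <->
  (forall W, disk_nbhs W ->
    exists2 r, 0 < r & forall T, nodes J m T -> dilation r W (ddiff c T)).
Proof.
rewrite /ddiff_bounded vboundedP; split=> H W /H[r r0 Hr]; exists r => //.
  by move=> T nT; apply: Hr; exists T.
by move=> _ [T nT ->]; exact: Hr.
Qed.

Lemma ddiff_bounded_upto m (c : R -> E) (J : set R) : (forall i, (i <= m)%N -> ddiff_bounded J i c) ->
  vbounded [set x | exists i T, [/\ (i <= m)%N, nodes J i T & x = ddiff c T]].
Proof.
elim: m => [|m IH] bc.
  apply: vboundedS (bc 0%N isT) => _ [[|i] [T [// _ nT ->]]]; by exists T.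
apply: vboundedS (vboundedU (IH _) (bc m.+1 _)) => [_ [i [T [im nT ->]]]|i im|//]; last first.
  by apply: bc; exact: leqW.
move: im; rewrite leq_eqVlt => /orP[/eqP e|im]; first by right; exists T; rewrite // -e.
by left; exists i, T.
Qed.

End DividedDifferences.

(** * Curves of class Lip^n and bounded divided differences *)

Section LipCurves.
Variables (R : realType) (E : tvsType R).
Hypothesis hausE : hausdorff_space E.
Implicit Types (A B W : set E) (T : seq R) (c d : R -> E) (l x y z : E) (a b r s t h : R).

Definition segment_ball (N : R) : set R := [set t | `|t| <= N].

Definition locally_ddiff_bounded m c := forall N : R, ddiff_bounded (segment_ball N) m c.

(** A curve that escapes from all multiples of [W] on a bounded interval does so
    near a single point, where it is continuous. *)
Lemma derivable_bounded c : (forall t, curve_derivable c t) -> locally_ddiff_bounded 0 c.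
Proof.
move=> dc N; apply/ddiff_boundedP => W dW; apply: contrapT => nb.
have bad (n : nat) : exists t, `|t| <= N /\ ~ dilation n.+1%:R W (c t).
  apply: contrapT => nt; apply: nb; exists n.+1%:R => // -[|t [|t' T]] [_ // _ TN].
  by apply: contrapT => nW; apply: nt; exists t; split => //; apply: TN; rewrite mem_head.
have [x xbad] := choice bad.
have [s sN cl] : exists2 s, - N <= s <= N & forall e M, 0 < e ->
    exists2 n, (M <= n)%N & `|x n - s| < e.
  by apply: segment_cluster => n; rewrite -ler_norml; exact: (xbad n).1.
have [e e0 eW] := has_deriv_continuous (has_deriv_curve_derive (dc s)) dW.
have [r r0 rc] := absorbs_point (c s) dW.
have [n Mn xn] := cl e (Num.truncn r).+1 e0.
apply: (xbad n).2.
have := dilationD dW.1 ler01 (ltW r0) (dilation1 (eW _ xn)) rc.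
rewrite (addrC s) !subrK; apply: (dilation_ge0_le dW.1); first by lra.
have := truncnS_gt r; rewrite -(@natr1 _ n) => rn.
have : (Num.truncn r).+1%:R <= n%:R :> R by rewrite ler_nat.
by move=> ?; lra.
Qed.

(** The divided difference of [c] on [a :: T] is the mean over [u] in the unit
    interval of the divided differences on [T] of [t |-> c' (u t + (1 - u) a)]. The
    latter are [u ^+ m] times divided differences of [c'], and the mean value
    theorem replaces the integral. *)
Lemma primitive_ddiff_bounded m c c' N : (forall t, has_deriv c t (c' t)) ->
  ddiff_bounded (segment_ball N) m c' -> ddiff_bounded (segment_ball N) m.+1 c.
Proof.
move=> dc /ddiff_boundedP bc'; apply/ddiff_boundedP => W dW.
have [r r0 rW] := bc' W dW; exists (r + 1); first by rewrite addr_gt0.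
move=> [|a T] [// /andP[aT uT] [sT] TN].
have aN : `|a| <= N by apply: TN; rewrite mem_head.
have nT : T != [::] by rewrite -size_eq0 sT.
pose psi u := ddiff (fun t => (t - a)^-1 *: (c ((t - a) * u + a) - c a)) T.
have psi0 : psi 0 = 0.
  rewrite -[RHS](scale0r (ddiff (fun=> 0) T)) -ddiffZ; apply: eq_ddiff => t _.
  by rewrite mulr0 add0r subrr scaler0 scale0r.
have psi1 : psi 1 = ddiff c (a :: T).
  by rewrite ddiff_cons//; apply: eq_ddiff => t _; rewrite mulr1 subrK.
have [|u /andP[u0 u1]|z Wz] := @mean_value_approx _ _ psi 0 1 (dilation r W) W ltr01 _ dW.
- by apply: disk_convex; apply: disk_dilation; exact: dW.1.
- exists (ddiff (fun t => (t - a)^-1 *: ((t - a) *: c' ((t - a) * u + a))) T); last first.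
    apply: (@has_deriv_ddiff _ _ (fun u t => (t - a)^-1 *: (c ((t - a) * u + a) - c a))) => t tT.
    apply: has_derivZ; rewrite -[_ *: _]addr0; apply: has_derivD; last exact: has_deriv_cst.
    exact: has_deriv_affine.
  rewrite (@eq_ddiff _ _ _ (fun t => c' (u * t + (1 - u) * a))); last first.
    move=> t tT; rewrite scalerA mulVf ?scale1r; last first.
      by rewrite subr_eq0; apply: contraNneq aT => <-.
    by congr c'; ring.
  rewrite ddiff_affine sT /=.
  have [[u00 m0]|um] : (u = 0 /\ m != 0%N) \/ (u != 0 \/ m = 0%N).
    have [->|] := eqVneq u 0; last by right; left.
    by have [->|] := eqVneq m 0%N; [right; right|left].
    by rewrite u00 expr0n (negbTE m0) scale0r; exact: dilation0 dW.1 _.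
  have nuT : nodes (segment_ball N) m [seq u * s + (1 - u) * a | s <- T].
    split; [|by rewrite size_map|].
      case: um => [un0|m0]; last first.
        by move: sT; rewrite m0; case: (T) => [|? []].
      rewrite map_inj_uniq // => s t /addIr; exact: mulfI.
    move=> _ /mapP[s sT' ->]; rewrite /segment_ball /=.
    have sN : `|s| <= N by apply: TN; rewrite inE sT' orbT.
    rewrite (le_trans (ler_normD _ _))// !normrM (ger0_norm u0) [`|1 - u|]ger0_norm ?subr_ge0//.
    have : u * `|s| <= u * N by rewrite ler_wpM2l.
    have : (1 - u) * `|a| <= (1 - u) * N by rewrite ler_wpM2l ?subr_ge0.
    by lra.
  apply: (dilation_le dW.1) (dilationZ _ (rW _ nuT)).
  rewrite normrM ler_piMl// normrX ger0_norm//.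
  exact: exprn_ile1.
rewrite psi1 psi0 !subr0 scale1r => Wz'.
by rewrite -(subrK z (ddiff c _)) addrC; apply: (dilationD dW.1) => //; exact: ltW.
Qed.

Lemma order0_ddiff_bounded c : locally_ddiff_bounded 1 c -> locally_ddiff_bounded 0 c.
Proof.
move=> bc N; apply/ddiff_boundedP => W dW.
have [M M0 NM] : exists2 M, 0 < M & N < M.
  by exists (`|N| + 1); [rewrite ltr_wpDl|have := ler_norm N; lra].
have [r r0 rW] := (ddiff_boundedP _ _ _).1 (bc M) W dW.
have [s s0 cW] := absorbs_point (c M) dW.
exists (s + (M + M) * r); first by rewrite addr_gt0// mulr_gt0// addr_gt0.
move=> [|t [|? ?]] [// _ _ tN].
have {tN} tN : `|t| <= N by apply: tN; rewrite mem_head.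
have tM : t < M by rewrite (le_lt_trans (ler_norm _))// (le_lt_trans tN).
have nT : nodes (segment_ball M) 1 [:: M; t].
  split=> //; first by rewrite /= inE gt_eqF.
  move=> u; rewrite !inE /segment_ball /= => /orP[/eqP->|/eqP->]; first by rewrite gtr0_norm.
  by rewrite (le_trans tN)// ltW.
have := dilationZ (t - M) (rW _ nT).
rewrite /= /dquot scalerA divff ?scale1r ?subr_eq0 ?lt_eqF// => Wt.
rewrite -(subrK (c M) (c t)) [c t - _ + _]addrC; apply: (dilationD dW.1) => //.
- exact: ltW.
- by rewrite mulr_ge0 ?addr_ge0// ltW.
- apply: (dilation_le dW.1) Wt; rewrite !normrM ler_wpM2r//.
  have : `|t| <= M by rewrite (le_trans tN)// ltW.
  rewrite [`|M + M|]gtr0_norm ?addr_gt0// => tM'.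
  by rewrite (le_trans (ler_normB _ _))// [`|M|]gtr0_norm// lerD2r.
Qed.

Lemma smooth_ddiff_bounded m c : smooth_curve c -> locally_ddiff_bounded m c.
Proof.
elim: m c => [|m IH] c sc.
  by apply: derivable_bounded; exact: sc 1%N 0%N _.
move=> N; apply: (@primitive_ddiff_bounded _ _ (curve_derive c)).
  by move=> t; apply/has_deriv_curve_derive; exact: sc 1%N 0%N _ t.
apply: IH => n j jn t; have := sc n.+1 j.+1 jn t.
by rewrite /curve_deriven iterSr.
Qed.

Lemma lipn_ddiff_bounded n m c : lipn_curve n c -> (m <= n.+1)%N -> locally_ddiff_bounded m c.
Proof.
elim: n m c => [|n IH] m c [dc lc] mn.
  have b1 : locally_ddiff_bounded 1 c.
    move=> N; have /lc : bounded_set (segment_ball N).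
      by exists N; split; [exact: num_real|move=> M NM t /= tN; rewrite (le_trans tN)// ltW].
    apply: vboundedS => _ [[|s [|t [|? ?]]] [ust sz TN] ->] //.
    have st : s != t by move: ust; rewrite /= inE andbT.
    exists t, s; split => //.
    - by apply: TN; rewrite !inE eqxx orbT.
    - by apply: TN; rewrite mem_head.
  by case: m mn => [_|[_|//]]; [exact: order0_ddiff_bounded|exact: b1].
have dc0 t : curve_derivable c t by exact: dc 0%N isT t.
case: m mn => [|m] mn; first exact: derivable_bounded.
move=> N; apply: (@primitive_ddiff_bounded _ _ (curve_derive c)).
  by move=> t; exact/has_deriv_curve_derive.
apply: IH => //; split; last by move: lc; rewrite /curve_deriven iterSr.
by move=> j jn t; have := dc j.+1 jn t; rewrite /curve_deriven iterSr.
Qed.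

Lemma separation_radius (s : seq R) :
  exists2 e : R, 0 < e & forall x : R, x \in s -> x != 0 -> e <= `|x|.
Proof.
elim: s => [|y s [e e0 es]]; first by exists 1.
have [->|y0] := eqVneq y 0.
  by exists e => // x; rewrite inE => /orP[/eqP->|/es//]; rewrite eqxx.
exists (Num.min e `|y|); first by rewrite lt_min e0 normr_gt0.
move=> x; rewrite inE ge_min => /orP[/eqP->|/es xs x0]; first by rewrite lexx orbT.
by rewrite xs.
Qed.

Lemma shifted_nodes_uniq T : uniq T ->
  exists2 e : R, 0 < e & forall h, h != 0 -> `|h| < e -> uniq (T ++ [seq t + h | t <- T]).
Proof.
move=> uT; have [e e0 es] := separation_radius [seq u - t | u <- T, t <- T].
exists e => // h h0 he; rewrite cat_uniq uT map_inj_uniq ?uT ?andbT; last exact: addIr.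
apply/hasPn => _ /mapP[t tT ->]; apply/negP => thT.
have := es (t + h - t) (allpairs_f (fun u t => u - t) thT tT).
by rewrite addrAC subrr add0r h0 leNgt he => /(_ isT).
Qed.

(** Induction on [T]: shifting the first node of [T] costs [h] times one divided
    difference of the next order, and the unshifted node then joins [A]. *)
Lemma ddiff_shift_dilation m c J W (r : R) (A T : seq R) h : 0 <= r -> disk W ->
  (forall S, nodes J m.+1 S -> dilation r W (ddiff c S)) ->
  uniq (A ++ T ++ [seq t + h | t <- T]) ->
  (size A + size T = m.+1)%N ->
  (forall t, t \in A ++ T ++ [seq t + h | t <- T] -> J t) ->
  dilation (h * ((size T)%:R * r)) W (ddiff c (A ++ [seq t + h | t <- T]) - ddiff c (A ++ T)).
Proof.
move=> r0 dW cW; elim: T A => [|b T IH] A.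
  by move=> _ _ _; rewrite subrr; exact: dilation0.
move=> uAT sAT JAT /=.
set Th := [seq t + h | t <- T].
have uAbT : uniq (A ++ [:: b, b + h & Th]).
  apply: subseq_uniq uAT; rewrite /=; apply: cat_subseq (subseq_refl _) _.
  by rewrite /= eqxx; exact: suffix_subseq.
have uAT' : uniq (rcons A b ++ T ++ Th).
  apply: subseq_uniq uAT; rewrite cat_rcons; apply: cat_subseq (subseq_refl _) _.
  rewrite /= eqxx; apply: cat_subseq (subseq_refl _) _; exact: subseq_cons.
have JAbT t : t \in A ++ [:: b, b + h & Th] -> J t.
  rewrite mem_cat !inE => tAb; apply: JAT; rewrite /= -/Th mem_cat inE mem_cat inE.
  by case/or4P: tAb => -> //; rewrite !orbT.
have JAT' t : t \in rcons A b ++ T ++ Th -> J t.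
  rewrite mem_cat mem_rcons inE mem_cat => tAb; apply: JAT.
  rewrite /= -/Th mem_cat inE mem_cat inE.
  by case/orP: tAb => [/orP[|]|/orP[|]] => ->; rewrite ?orbT.
have sAT' : (size (rcons A b) + size T = m.+1)%N by rewrite size_rcons -sAT addSnnS.
have := IH _ uAT' sAT' JAT'; rewrite -/Th !cat_rcons => WT.
have nAbT : nodes J m.+1 (A ++ [:: b, b + h & Th]).
  by split=> //; rewrite size_cat /= size_map -sAT /= !addnS.
have := ddiff_exchange c uAbT; rewrite addrAC subrr add0r => ex.
have := dilationZ h (cW _ nAbT); rewrite -ex => Wb.
have := dilationD dW _ _ (dilation_abs dW Wb) (dilation_abs dW WT).
move=> /(_ (normr_ge0 _) (normr_ge0 _)).
rewrite addrA subrK; apply: dilation_le => //.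
have nr n : 0 <= n%:R * r by rewrite mulr_ge0.
rewrite !normrM (ger0_norm r0) !normr_nat -mulrDr normrM normr_id ler_wpM2l//.
by rewrite ger0_norm ?addr_ge0// -natr1 mulrDl mul1r addrC.
Qed.

(** Divided differences of [c'] are limits of increments of those of [c] under a
    common translation [h] of the nodes; exchanging the nodes [t] for [t + h] one
    at a time expresses such an increment as [h] times a sum of divided differences
    of one order more. *)
Lemma derivative_ddiff_bounded m c c' : (forall t, has_deriv c t (c' t)) ->
  locally_ddiff_bounded m.+1 c -> locally_ddiff_bounded m c'.
Proof.
move=> dc bc N; apply/ddiff_boundedP => W dW.
have [r r0 rW] := (ddiff_boundedP _ _ _).1 (bc (N + 1)) W dW.
exists (m.+1%:R * r + 1); first by rewrite ltr_wpDl// mulr_ge0// ltW.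
move=> T [uT sT TN].
have dT : has_deriv (fun u => ddiff (fun t => c (1 * u + t)) T) 0 (ddiff (fun t => c' (1 * 0 + t)) T).
  apply: has_deriv_ddiff => t _.
  rewrite -[c' _]scale1r; exact: has_deriv_affine.
have eT u : ddiff (fun t => c (1 * u + t)) T = ddiff c [seq t + u | t <- T].
  have -> : [seq t + u | t <- T] = [seq 1 * t + u | t <- T] by apply: eq_map => t; rewrite mul1r.
  have := ddiff_affine c 1 u T; rewrite expr1n scale1r => <-.
  by apply: eq_ddiff => t _; rewrite !mul1r addrC.
have [e e0 eu] := shifted_nodes_uniq uT.
have [e' e0' eW] := dT W dW.
pose h := Num.min (Num.min e e') 1 / 2.
have hmin : 0 < Num.min (Num.min e e') 1 by rewrite !lt_min e0 e0' ltr01.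
have h0 : 0 < h by rewrite divr_gt0.
have : h < Num.min (Num.min e e') 1 by rewrite /h; lra.
rewrite !lt_min => /andP[/andP[he he'] h1].
have hn : `|h| = h by rewrite gtr0_norm.
have uTh : uniq ([::] ++ T ++ [seq t + h | t <- T]) by apply: eu; rewrite ?gt_eqF// hn.
have JT t : t \in [::] ++ T ++ [seq t + h | t <- T] -> segment_ball (N + 1) t.
  rewrite cat0s mem_cat /segment_ball /= => /orP[/TN tN|/mapP[u /TN uN ->]].
    by rewrite (le_trans tN)// lerDl.
  by rewrite (le_trans (ler_normD _ _))// hn lerD// ltW.
have W1 := ddiff_shift_dilation (ltW r0) dW.1 rW uTh sT JT.
have := eW h; rewrite hn => /(_ he') /(dilationB_sym dW.1) W2.
have mr0 : 0 <= m.+1%:R * r by rewrite mulr_ge0// ltW.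
have := dilationD dW.1 _ _ W2 W1.
rewrite !cat0s sT eT eT add0r => /(_ (ltW h0) (mulr_ge0 (ltW h0) mr0)).
have -> : [seq t + 0 | t <- T] = T by rewrite -[RHS]map_id; apply: eq_map => t; rewrite addr0.
rewrite subrK => /(dilationZ h^-1).
rewrite scalerA mulVf ?gt_eqF// scale1r.
have -> : h^-1 * (h + h * (m.+1%:R * r)) = m.+1%:R * r + 1 by field; rewrite gt_eqF.
rewrite (@eq_ddiff _ _ _ c') // => t _; by rewrite mul1r add0r.
Qed.

(** The hull is an intersection of dilations whose factors [s] strictly exceed the
    factors [r] that absorb [A]; this strictness makes the intersection closed. *)
Lemma closed_disk_hull A : vbounded A ->
  exists B, [/\ closed B, disk B, vbounded B & A `<=` B].
Proof.
move=> /vboundedP bA.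
exists [set x | forall W r s, disk_nbhs W -> 0 < r -> r < s ->
  A `<=` dilation r W -> dilation s W x]; split.
- move=> x clx W r s dW r0 rs Ar.
  have sr : 0 < (s - r) / 2 by lra.
  have [y [/(_ W r ((r + s) / 2) dW r0)]] := clx _ (disk_nbhs_nbhs x (disk_nbhs_dilation sr dW)).
  move=> /(_ _ Ar) By /= xy.
  have /By {}By : r < (r + s) / 2 by lra.
  have := dilationB dW.1 _ _ By xy; rewrite opprB addrCA subrr addr0.
  have -> : (r + s) / 2 + (s - r) / 2 = s by field.
  by apply; lra.
- split; last by move=> W r s dW *; exact: dilation0 dW.1 _.
  move=> a b x y ab Bx By W r s dW r0 rs Ar.
  by apply: (disk_dilation dW.1 s).1 => //; [exact: (Bx W r)|exact: (By W r)].
- apply/vboundedP => W dW; have [r r0 Ar] := bA W dW.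
  by exists (r + 1); [exact: addr_gt0|move=> x Bx; apply: (Bx W r); rewrite // ltrDl].
- by move=> x Ax W r s dW r0 rs /(_ x Ax); apply: (dilation_ge0_le dW.1); exact: ltW.
Qed.

Lemma pow2_small (e : R) : 0 < e -> exists2 n, (0 < n)%N & 4 * 2^-1 ^+ n < e.
Proof.
move=> e0; have := truncnS_gt (4 / e); set n := Num.truncn _; move=> en.
have np : 0 < n.+1%:R :> R by rewrite ltr0n.
exists n.+1 => //; apply: (@le_lt_trans _ _ (4 / n.+1%:R)).
  rewrite exprVn ler_pM2l// lef_pV2 ?posrE ?exprn_gt0//.
  by rewrite -natrX ler_nat ltnW// ltn_expl.
by rewrite ltr_pdivrMr// mulrC -ltr_pdivrMr.
Qed.

(** In a locally complete space, sequences whose increments decrease geometrically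
    with respect to a closed bounded disk [B] converge, because they are Cauchy in
    the Banach space spanned by [B]. *)
Lemma Mackey_limit B (x : nat -> E) : locally_complete E ->
  closed B -> disk B -> vbounded B ->
  (forall n, dilation (2^-1 ^+ n) B (x n.+1 - x n)) ->
  exists y, forall n, dilation (3 * 2^-1 ^+ n) B (y - x n).
Proof.
move=> lcE clB dB bB xB.
have [X [i [inji rangei normi]]] := lcE B clB dB.1 bB.
have mink_le r z : 0 < r -> dilation r B z -> minkowski B z <= r.
  move=> r0 [b Bb ->]; apply: ge_inf; first by exists 0 => t [/ltW].
  by split=> //; exists b.
have mink_lt r z : linear_span B z -> minkowski B z < r -> dilation r B z.
  move=> Bz mr.
  have hm : [set t : R | 0 < t /\ [set t *: a | a in B] z] !=set0.
    suff [t t0 [b Bb ->]] : [set z | exists2 t : R, 0 < t & dilation t B z] z.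
      by exists t; split => //; exists b.
    apply: Bz.
    - by exists 1 => //; exact: dilation0 dB _.
    - move=> a u v [t t0 Bu] [s s0 Bv]; exists (`|a| * t + s).
        by rewrite ltr_wpDl// mulr_ge0// ltW.
      apply: dilationD => //; [by rewrite mulr_ge0// ltW|exact: ltW|].
      by apply: (dilation_le dB) (dilationZ a Bu); rewrite !normrM normr_id.
    - by move=> b Bb; exists 1 => //; exact: dilation1.
  have [t [t0 [b Bb <-]] tr] := inf_lt hm mr.
  by apply: (@dilation_ge0_le _ _ _ dB t); [exact: ltW|exact: ltW|exists b].
have spanB r z : dilation r B z -> linear_span B z.
  move=> [b Bb ->] V V0 VZ BV; rewrite -[_ *: b]addr0; apply: VZ => //; exact: BV.
have two0 n : 0 < 2^-1 ^+ n :> R by rewrite exprn_gt0.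
have span_sum n : linear_span B (x n - x 0%N).
  elim: n => [|n IH]; first by rewrite subrr; move=> V V0.
  move=> V V0 VZ BV; rewrite -[x n.+1](subrK (x n)) -addrA -[_ - _]scale1r.
  by apply: (VZ); [exact: spanB (xB n) V V0 VZ BV|exact: IH].
have uex n : exists v, i v = x n - x 0%N.
  by have := span_sum n; rewrite -rangei => -[v _ <-]; exists v.
have [u iu] := choice uex.
have uB n : `|u n.+1 - u n| <= 2^-1 ^+ n.
  rewrite normi linearB !iu opprB addrA subrK; exact: mink_le.
have uB2 n k : `|u (n + k)%N - u n| <= 2 * 2^-1 ^+ n.
  suff : `|u (n + k)%N - u n| <= 2 * 2^-1 ^+ n - 2 * 2^-1 ^+ (n + k)%N.
    by move/le_trans; apply; rewrite gerBl mulr_ge0// ltW.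
  elim: k => [|k IH]; first by rewrite addn0 !subrr normr0.
  rewrite addnS -(subrK (u (n + k)%N) (u _.+1)) -addrA (le_trans (ler_normD _ _))//.
  have := uB (n + k)%N; rewrite exprS; lra.
have cu : cvg (u @ \oo).
  apply/cauchy_cvgP/cauchy_ballP => e e0.
  have [n n0 ne] := pow2_small e0.
  exists (u @` [set k | (n <= k)%N], u @` [set k | (n <= k)%N]) => /=.
    by split; exists n => // k nk; exists k.
  move=> [_ _] /= [[k1 nk1 <-] [k2 nk2 <-]]; rewrite -ball_normE /ball_ /=.
  have := uB2 n (k1 - n)%N; have := uB2 n (k2 - n)%N; rewrite !subnKC// => ? ?.
  rewrite -(subrK (u n) (u k1)) -addrA (le_lt_trans (ler_normD _ _))//.
  by rewrite [`|u n - _|]distrC; lra.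
exists (i (lim (u @ \oo)) + x 0%N) => n.
have -> : i (lim (u @ \oo)) + x 0%N - x n = i (lim (u @ \oo) - u n).
  by rewrite linearB iu opprB addrA.
apply: mink_lt; first by rewrite -rangei; exists (lim (u @ \oo) - u n).
rewrite -normi; have := two0 n => p0.
suff : `|lim (u @ \oo) - u n| <= 2 * 2^-1 ^+ n by lra.
have cun : (fun k => `|u k - u n|) @ \oo --> `|lim (u @ \oo) - u n|.
  apply: cvg_norm; apply: cvgB => //; exact: cvg_cst.
rewrite -(cvg_lim _ cun)//; apply: limr_le; first by apply/cvg_ex; eexists; exact: cun.
exists n => // k /= nk; have := uB2 n (k - n)%N; by rewrite subnKC.
Qed.

(** The difference quotients at [t] along the step [2^-n] are Mackey-Cauchy since
    their mutual differences are step sizes times second divided differences. *)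
Lemma ddiff_bounded_derivable c : locally_complete E -> locally_ddiff_bounded 2 c ->
  forall t, curve_derivable c t.
Proof.
move=> lcE bc t.
have [B [clB dB bB AB]] := closed_disk_hull (bc (`|t| + 1)).
have quot_step h h' : h != 0 -> h' != 0 -> `|h| <= 1 -> `|h'| <= 1 ->
    dilation (h' - h) B (dquot c t (t + h') - dquot c t (t + h)).
  move=> h0 h0' h1 h1'; have [->|hh] := eqVneq h' h.
    by rewrite !subrr; exact: dilation0.
  have nT : nodes (segment_ball (`|t| + 1)) 2 [:: t; t + h; t + h'].
    split=> //.
      rewrite /= !inE negb_or andbT -!(subr_eq0 t) -!(subr_eq0 (t + h)).
      rewrite !opprD !addrA subrr !sub0r !oppr_eq0 h0 h0' /=.
      by rewrite [t + h]addrC addrK subr_eq0 eq_sym.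
    move=> u; rewrite !inE /segment_ball /= => /or3P[] /eqP ->; first by rewrite lerDl.
      by rewrite (le_trans (ler_normD _ _))// lerD2l.
    by rewrite (le_trans (ler_normD _ _))// lerD2l.
  exists (ddiff c [:: t; t + h; t + h']); first by apply: AB; exists [:: t; t + h; t + h'].
  rewrite /= {3}/dquot.
  have -> : t + h' - (t + h) = h' - h by ring.
  by rewrite scalerA divff ?scale1r// subr_eq0.
have two0 n : 2^-1 ^+ n != 0 :> R by rewrite expf_neq0// invr_eq0.
have two0' n : 0 <= 2^-1 ^+ n :> R by rewrite exprn_ge0.
have two1 n : `|2^-1 ^+ n| <= 1 :> R.
  by rewrite ger0_norm// exprn_ile1//; lra.
have [l xl] : exists l, forall n, dilation (3 * 2^-1 ^+ n) B (l - dquot c t (t + 2^-1 ^+ n)).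
  apply: (Mackey_limit lcE clB dB bB) => n.
  apply: (dilation_le dB) (quot_step _ _ (two0 _) (two0 _) (two1 _) (two1 _)).
  by rewrite exprS; have := two0' n => ?; rewrite ler0_norm ?ger0_norm; lra.
apply: (@has_deriv_derivable _ _ _ _ l) => W dW.
have [r r0 Br] := (vboundedP _).1 bB W dW.
have r2 : 0 < (2 * r)^-1 by rewrite invr_gt0 mulr_gt0.
exists (Num.min 1 (2 * r)^-1); first by rewrite lt_min ltr01.
move=> h; rewrite lt_min => /andP[h1 hr].
have [->|h0] := eqVneq h 0.
  by rewrite addr0 subrr scale0r subr0; exact: dilation0 dW.1 _.
have hp : 0 < `|h| by rewrite normr_gt0.
have [n n0 nh] := pow2_small hp.
have := dilationB dB _ _ (dilation_abs dB (quot_step _ _ (two0 n) h0 (two1 n) (ltW h1))) (xl n).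
have -> : dquot c t (t + h) - dquot c t (t + 2^-1 ^+ n) - (l - dquot c t (t + 2^-1 ^+ n)) =
  dquot c t (t + h) - l by rewrite opprB addrA subrK.
have l0 : 0 <= 3 * 2^-1 ^+ n :> R by rewrite mulr_ge0.
move=> /(_ (normr_ge0 _) l0) Bq.
have {}Bq : dilation (2 * `|h|) B (dquot c t (t + h) - l).
  apply: (dilation_ge0_le dB) Bq; first by rewrite addr_ge0.
  have := ler_normB h (2^-1 ^+ n); rewrite [`|2^-1 ^+ n|]ger0_norm//; lra.
have /(dilationZ h) := dilation_dilation (dilationS Br Bq).
have -> : h *: (dquot c t (t + h) - l) = c (t + h) - c t - h *: l.
  rewrite scalerBr /dquot scalerA.
  have -> : t + h - t = h by ring.
  by rewrite divff// scale1r.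
apply: (dilation_le dW.1); rewrite !normrM normr_id ler_piMr// [`|r|]gtr0_norm//.
rewrite [`|2|]gtr0_norm// mulrAC mulrC -ler_pdivlMr ?mulr_gt0// div1r.
exact: ltW.
Qed.

(** Each derivation lowers by one the order up to which the divided differences are
    known to be bounded; existence of the derivative needs the second order. *)
Lemma ddiff_bounded_lipn n c : locally_complete E ->
  (forall m, (0 < m <= n.+1)%N -> locally_ddiff_bounded m c) -> lipn_curve n c.
Proof.
move=> lcE; elim: n c => [|n IH] c bc.
  split=> // J [M [_ MJ]].
  apply: vboundedS (bc 1%N isT (M + 1)) => _ [t [s [Jt Js st ->]]].
  exists [:: s; t] => //; split=> //; first by rewrite /= inE st.
  have JM u : J u -> `|u| <= M + 1 by apply: MJ; rewrite ltrDl.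
  by move=> u; rewrite !inE => /orP[] /eqP ->; exact: JM.
have dc : forall t, curve_derivable c t by apply: ddiff_bounded_derivable (bc 2%N _).
have [|dc' lc'] := IH (curve_derive c).
  move=> m /andP[m0 mn]; apply: derivative_ddiff_bounded (bc m.+1 _).
    by move=> t; exact: has_deriv_curve_derive.
  by rewrite /= ltnS.
split; last by rewrite /curve_deriven iterSr.
case=> [|j] jn t; first exact: dc.
by rewrite /curve_deriven iterSr; exact: dc'.
Qed.

End LipCurves.

(** * A smooth bump function *)

Section Bump.
Variable R : realType.
Implicit Types (f g : R -> R) (x y : R) (n m : nat).

(** Only the existence of the derivatives is recorded, which makes sums, products
    and composites plain inductions on [n]. *)
Fixpoint differentiable_upto n f : Prop :=
  if n is n'.+1 then
    exists2 f', (forall x, is_derive x 1 f (f' x)) & differentiable_upto n' f'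
  else True.

Lemma differentiable_uptoW n f : differentiable_upto n.+1 f -> differentiable_upto n f.
Proof. by elim: n f => // n IH f [f' df /IH]; exists f'. Qed.

Lemma differentiable_upto_cst n a : differentiable_upto n (fun=> a).
Proof.
elim: n a => // n IH a; exists (fun=> 0) => // x; exact: is_derive_cst.
Qed.

Lemma differentiable_upto_id n : differentiable_upto n id.
Proof.
case: n => // n; exists (fun=> 1); first by move=> x; exact: is_derive_id.
exact: differentiable_upto_cst.
Qed.

Lemma differentiable_uptoD n f g : differentiable_upto n f -> differentiable_upto n g ->
  differentiable_upto n (fun x => f x + g x).
Proof.
elim: n f g => // n IH f g [f' df cf] [g' dg cg]; exists (fun x => f' x + g' x); last exact: IH.
move=> x; exact: is_deriveD.
Qed.

Lemma differentiable_uptoM n f g : differentiable_upto n f -> differentiable_upto n g ->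
  differentiable_upto n (fun x => f x * g x).
Proof.
elim: n f g => // n IH f g cf cg.
have [cf0 cg0] := (differentiable_uptoW cf, differentiable_uptoW cg).
case: cf cg => [f' df cf] [g' dg cg]; exists (fun x => f x * g' x + g x * f' x).
  by move=> x; exact: is_deriveM.
by apply: differentiable_uptoD; apply: IH.
Qed.

Lemma differentiable_upto_comp n f g : differentiable_upto n f -> differentiable_upto n g ->
  differentiable_upto n (fun x => f (g x)).
Proof.
elim: n f g => // n IH f g cf cg.
have cg0 := differentiable_uptoW cg.
case: cf cg => [f' df cf] [g' dg cg]; exists (fun x => f' (g x) * g' x).
  by move=> x; exact: is_derive1_comp.
by apply: differentiable_uptoM => //; exact: IH.
Qed.

(** All powers [m] are treated together because the derivative of one of these
    functions is a linear combination of two others. *)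
Definition flat m x : R := if x <= 0 then 0 else x ^- m * expR (- x^-1).

Lemma flat_pos m x : 0 < x -> flat m x = x ^- m * expR (- x^-1).
Proof. by move=> x0; rewrite /flat leNgt x0. Qed.

Lemma flat_neg m x : x <= 0 -> flat m x = 0.
Proof. by move=> x0; rewrite /flat x0. Qed.

(** The quadratic bound yields the derivative [0] at the origin. *)
Lemma flat_le m x : 0 < x -> flat m x <= (m.+2)`!%:R * x ^+ 2.
Proof.
move=> x0; rewrite flat_pos// expRN.
have xi : 0 < x^-1 by rewrite invr_gt0.
have := expR_ge1Dxn m.+1 (ltW xi).
set F : R := (m.+2)`!%:R; have F0 : 0 < F by rewrite ltr0n fact_gt0.
move=> h.
have {h} h : x^-1 ^+ m.+2 / F <= expR x^-1 by apply: le_trans h; rewrite lerDr.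
have p0 : 0 < x^-1 ^+ m.+2 / F by rewrite divr_gt0// exprn_gt0.
apply: (@le_trans _ _ (x ^- m * (x^-1 ^+ m.+2 / F)^-1)).
  by rewrite ler_pM2l ?invr_gt0 ?exprn_gt0// lef_pV2 ?posrE ?expR_gt0.
have x00 : x != 0 by rewrite gt_eqF.
rewrite invf_div exprVn invrK mulrCA ler_pM2l// -addn2 exprD mulrA mulVf ?mul1r//.
by rewrite expf_neq0.
Qed.

(** This makes uniqueness, locality and boundedness results on curves available for
    scalar functions. *)
Lemma is_derive_has_deriv f x l : is_derive x 1 f l <-> has_deriv (f : R -> R^o) x l.
Proof.
have e : curve_quotient (f : R -> R^o) x = (fun h => h^-1 *: ((f \o shift x) (h *: 1) - f x)).
  by apply/funext => h; rewrite /curve_quotient /= /shift /= [h *: 1]mulr1.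
split=> [[df <-]|/has_derivP dl]; first by apply/has_derivP; rewrite e; exact: df.
rewrite e in dl.
have cdl : derivable f x 1 by apply/cvg_ex; exists l.
split=> //; exact: cvg_lim dl.
Qed.

Lemma disk_nbhs_line (W : set R^o) : disk_nbhs W ->
  exists2 e : R, 0 < e & forall x : R, `|x| <= e -> W x.
Proof.
move=> [_ /nbhs_ballP[e /= e0 eW]]; exists (e / 2); first by rewrite divr_gt0.
by move=> x xe; apply: eW; rewrite /ball /= sub0r normrN; lra.
Qed.

Lemma is_derive_flat m x : is_derive x 1 (flat m) (- m%:R * flat m.+1 x + flat m.+2 x).
Proof.
apply/is_derive_has_deriv.
have [x0|x0|->] := ltgtP x 0.
- have -> : - m%:R * flat m.+1 x + flat m.+2 x = 0 by rewrite !flat_neg ?ltW// mulr0 addr0.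
  apply: (@has_deriv_near _ _ _ (fun=> 0) _ _ (- x)); last exact: has_deriv_cst.
    by rewrite oppr_gt0.
  move=> s; rewrite ltr_norml => /andP[_ sx]; rewrite flat_neg//; lra.
- apply: (@has_deriv_near _ _ _ (fun s => s ^- m * expR (- s^-1)) _ _ x) => //.
    move=> s; rewrite ltr_norml => /andP[sx _]; rewrite flat_pos//; lra.
  apply/is_derive_has_deriv.
  have xn0 : x != 0 by rewrite gt_eqF.
  have dV : is_derive x 1 (fun s : R => s^-1) (- x ^- 2).
    have -> : - x ^- 2 = - x ^- 2 *: (1 : R) by rewrite /GRing.scale /= mulr1.
    split; first by apply: derivableV => //; exact: derivable_id.
    by rewrite deriveV// derive_id.
  have dexp : is_derive x 1 (fun s : R => expR (- s^-1)) (expR (- x^-1) * x ^- 2).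
    have -> : expR (- x^-1) * x ^- 2 = expR (- x^-1) * (- - x ^- 2) by rewrite opprK.
    apply: is_derive1_comp; exact: is_deriveN.
  have dpow : is_derive x 1 (fun s : R => s ^- m) (- m%:R * x ^- m.+1).
    have xm0 : x ^+ m != 0 by rewrite expf_neq0.
    have dX : is_derive x 1 (fun s : R => s ^+ m) (m%:R * x ^+ m.-1).
      have := is_deriveX m (@is_derive_id R R x 1).
      by rewrite /GRing.scale /= mulr1 exprfctE.
    have -> : - m%:R * x ^- m.+1 = - (x ^+ m) ^- 2 *: (m%:R * x ^+ m.-1).
      rewrite /GRing.scale /=; case: (m) => [|n] /=; first by rewrite !(mul0r, oppr0, mulr0).
      by rewrite !exprS; field; rewrite xn0 expf_neq0.
    split; first by apply: derivableV => //; case: dX.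
    by rewrite deriveV// derive_val.
  have -> : - m%:R * flat m.+1 x + flat m.+2 x =
      x ^- m * (expR (- x^-1) * x ^- 2) + expR (- x^-1) * (- m%:R * x ^- m.+1).
    rewrite !flat_pos// -addn2 exprD; field.
    by rewrite !expf_neq0 ?xn0 /=.
  exact: (is_deriveM dpow dexp).
- rewrite !flat_neg// mulr0 addr0 => W /disk_nbhs_line[e e0 eW].
  exists (e / (m.+2)`!%:R); first by rewrite divr_gt0// ltr0n fact_gt0.
  move=> h; rewrite ltr_pdivlMr ?ltr0n ?fact_gt0// => he.
  have -> : flat m (0 + h) - flat m 0 - h *: (0 : R^o) = flat m h.
    by rewrite scaler0 subr0 add0r [flat m 0]flat_neg// subr0.
  have [h0|h0] := lerP h 0.
    exists 0; first by apply: eW; rewrite normr0 ltW.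
    by rewrite scaler0 flat_neg.
  exists (h^-1 * flat m h); last by rewrite /GRing.scale /= mulrA divff ?mul1r// gt_eqF.
  apply: eW; rewrite ger0_norm.
    rewrite mulrC ler_pdivrMr//; apply: le_trans (flat_le m h0) _.
    by rewrite expr2 mulrA ler_pM2r// mulrC -[h]gtr0_norm// ltW.
  rewrite mulr_ge0 ?invr_ge0 ?(ltW h0)// flat_pos//.
  by rewrite mulr_ge0 ?expR_ge0// invr_ge0 exprn_ge0// ltW.
Qed.

Lemma differentiable_upto_flat n m : differentiable_upto n (flat m).
Proof.
elim: n m => // n IH m; exists (fun x => - m%:R * flat m.+1 x + flat m.+2 x).
  exact: is_derive_flat.
by apply: differentiable_uptoD => //; apply: differentiable_uptoM => //; exact: differentiable_upto_cst.
Qed.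

Definition jet (F : nat -> R -> R) := forall r x, is_derive x 1 (F r) (F r.+1 x).

Lemma differentiable_upto_jet f : (forall n, differentiable_upto n f) ->
  exists2 F, jet F & F 0%N = f.
Proof.
move=> cf.
have step g : (forall n, differentiable_upto n g) ->
    (forall x, is_derive x 1 g (derive1 g x)) /\ forall n, differentiable_upto n (derive1 g).
  move=> cg; split=> [x|n].
    have [g' dg _] := cg 1%N; have := dg x => dgx.
    by rewrite derive1E derive_val.
  have [g' dg cg'] := cg n.+1.
  suff -> : derive1 g = g' by [].
  by apply/funext => x; have := dg x => dgx; rewrite derive1E derive_val.
exists (fun r => iter r (@derive1 R R) f) => // r.
have cr : forall n, differentiable_upto n (iter r (@derive1 R R) f).
  by elim: r => // r /step[].
exact: (step _ cr).1.
Qed.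

Lemma flat0_gt0 x : 0 < x -> 0 < flat 0 x.
Proof. by move=> x0; rewrite flat_pos// expr0 invr1 mul1r expR_gt0. Qed.

Lemma flat0_le x y : 0 < x -> x <= y -> flat 0 x <= flat 0 y.
Proof.
move=> x0 xy; have y0 := lt_le_trans x0 xy.
rewrite !flat_pos// !expr0 invr1 !mul1r ler_expR lerN2.
by rewrite lef_pV2.
Qed.

(** The argument of the outer [flat 0] is [1] where [y ^+ 2 <= 1 / 4] and at most [0] where
    [y ^+ 2 >= 1 / 2], so that the composite is constant on the former set and
    vanishes on the latter. *)
Lemma bump_jet : exists chi : nat -> R -> R,
  [/\ jet chi, forall y, `|y| <= 2^-1 -> chi 0%N y = 1,
      forall r y, 1 <= `|y| -> chi r y = 0 &
      forall r, exists2 C, 0 <= C & forall y, `|chi r y| <= C].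
Proof.
pose b y := (flat 0 1)^-1 * flat 0 (1 + (- (flat 0 4^-1)^-1) * flat 0 (y * y + - 4^-1)).
have [chi jchi chi0] : exists2 F, jet F & F 0%N = b.
  apply: differentiable_upto_jet => n.
  apply: differentiable_uptoM; first exact: differentiable_upto_cst.
  apply: differentiable_upto_comp; first exact: differentiable_upto_flat.
  apply: differentiable_uptoD; first exact: differentiable_upto_cst.
  apply: differentiable_uptoM; first exact: differentiable_upto_cst.
  apply: differentiable_upto_comp; first exact: differentiable_upto_flat.
  apply: differentiable_uptoD; last exact: differentiable_upto_cst.
  by apply: differentiable_uptoM; exact: differentiable_upto_id.
have b1 : flat 0 1 != 0 by rewrite gt_eqF// flat0_gt0.
have supp r y : 3 / 4 < `|y| -> chi r y = 0.
  elim: r y => [|r IH] y y34.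
    rewrite chi0 /b [X in _ * X]flat_neg ?mulr0//.
    have yy : 4^-1 <= y * y + - 4^-1.
      rewrite -[y * y]ger0_norm ?sqr_ge0// normrM.
      have : 3 / 4 * (3 / 4) <= `|y| * `|y| by apply: ler_pM; lra.
      by lra.
    rewrite mulNr subr_le0 mulrC ler_pdivlMr ?flat0_gt0// ?mul1r.
      exact: flat0_le.
  apply: (@has_deriv_unique _ R^o (chi r : R -> R^o) y); first exact: norm_hausdorff.
    exact/is_derive_has_deriv/jchi.
  apply: (@has_deriv_near _ _ _ (fun=> 0) _ _ (`|y| - 3 / 4)); last exact: has_deriv_cst.
    by lra.
  move=> s sy; apply: IH.
  by have := lerB_dist y s; rewrite distrC => ?; lra.
exists chi; split => //.
- move=> y y2; rewrite chi0 /b.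
  have -> : flat 0 (y * y + - 4^-1) = 0.
    rewrite flat_neg//.
    rewrite -[y * y]ger0_norm ?sqr_ge0// normrM.
    have : `|y| * `|y| <= 2^-1 * 2^-1 by apply: ler_pM.
    by lra.
  by rewrite mulr0 addr0 mulVf.
- by move=> r y y1; apply: supp; lra.
- move=> r.
  have dchi t : curve_derivable (chi r : R -> R^o) t.
    by apply: (@has_deriv_derivable _ _ _ _ (chi r.+1 t)); exact/is_derive_has_deriv/jchi.
  have nW : nbhs (0 : R^o) (ball (0 : R^o) 1) by exact: nbhsx_ballx.
  have /vboundedP bchi := derivable_bounded dchi 1.
  have [V dV V1] := nbhs0_disk nW; have [C C0 CV] := bchi V dV.
  exists C; first exact: ltW.
  move=> y; have [y1|y1] := lerP `|y| 1; last by rewrite supp ?normr0 ?ltW//; lra.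
  have [|v /V1] := CV (chi r y).
    by exists [:: y] => //; split => // u; rewrite inE => /eqP ->.
  rewrite /ball /= sub0r normrN => v1 ->.
  by rewrite normrM (gtr0_norm C0) ler_piMr ?ltW.
Qed.

End Bump.

(** * Smooth curves through fast converging polynomial arcs *)

Section JetProducts.
Variable R : realType.
Implicit Types (F : nat -> R -> R) (T : seq R).

(** Leibniz' rule: the second derivative of [y - d] vanishes, so that two terms
    remain. For [r = 0] the second one has the coefficient [0]. *)
Definition jet_mulXsub (d : R) F (r : nat) (y : R) : R :=
  (y - d) * F r y + r%:R * F r.-1 y.

Lemma jet_mulXsubP d F : jet F -> jet (jet_mulXsub d F).
Proof.
move=> jF r x.
have dX : is_derive x 1 (fun y : R => y - d) 1.
  have := is_deriveD (@is_derive_id R R x 1) (@is_derive_cst R R R (- d) x 1).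
  by rewrite addr0.
have dr : is_derive x 1 (fun y => r%:R * F r.-1 y) (r%:R * F r x).
  case: r => [|r] /=; last exact: (is_deriveZ r.+1%:R (jF r x)).
  rewrite mul0r; have -> : (fun y => 0 * F 0%N y) = cst 0 by apply/funext => y; rewrite mul0r.
  exact: is_derive_cst.
have -> : jet_mulXsub d F r.+1 x = ((x - d) *: F r.+1 x + F r x *: 1) + r%:R * F r x.
  by rewrite /jet_mulXsub /GRing.scale /= -natr1; ring.
exact: (is_deriveD (is_deriveM dX (jF r x)) dr).
Qed.

Definition jet_prod F T := foldr jet_mulXsub F T.

Lemma jet_prodP F T : jet F -> jet (jet_prod F T).
Proof. by move=> jF; elim: T => //= d T; exact: jet_mulXsubP. Qed.

Lemma jet_prod_support F T r y : (forall r, F r y = 0) -> jet_prod F T r y = 0.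
Proof.
move=> F0; elim: T r => //= d T IH r.
by rewrite /jet_mulXsub !IH !mulr0 addr0.
Qed.

Lemma jet_prod0 F T y : jet_prod F T 0 y = (\prod_(d <- T) (y - d)) * F 0%N y.
Proof.
elim: T => [|d T IH] /=; first by rewrite big_nil mul1r.
by rewrite /jet_mulXsub mul0r addr0 -/(jet_prod F T) IH big_cons mulrA.
Qed.

(** The point is the uniformity in [T], of which only the size is fixed. It holds
    because [F] vanishes off the unit interval, where the factors are bounded. *)
Lemma jet_prod_bounded F : (forall r y, 1 <= `|y| -> F r y = 0) ->
  (forall r, exists2 C, 0 <= C & forall y, `|F r y| <= C) ->
  forall k r, exists2 C, 0 <= C & forall T y, size T = k ->
    (forall d, d \in T -> `|d| <= 1) -> `|jet_prod F T r y| <= C.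
Proof.
move=> F0 bF; elim=> [|k IH] r.
  by have [C C0 FC] := bF r; exists C => // T y /size0nil ->.
have [C1 C10 FC1] := IH r; have [C2 C20 FC2] := IH r.-1.
exists (2 * C1 + r%:R * C2).
  by rewrite addr_ge0// mulr_ge0.
move=> [//|d T] y [sT] dT.
have [y1|y1] := lerP 1 `|y|.
  rewrite jet_prod_support ?normr0; last by move=> r'; exact: F0.
  by rewrite addr_ge0// mulr_ge0.
have d1 : `|d| <= 1 by apply: dT; rewrite mem_head.
have T1 d' : d' \in T -> `|d'| <= 1 by move=> d'T; apply: dT; rewrite inE d'T orbT.
rewrite /= /jet_mulXsub -/(jet_prod F T) (le_trans (ler_normD _ _))// !normrM normr_nat.
apply: lerD; last by rewrite ler_wpM2l// FC2.
apply: ler_pM => //; last exact: FC1.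
by rewrite (le_trans (ler_normB _ _))//; lra.
Qed.

End JetProducts.

Section SpecialCurve.
Variables (R : realType) (E : tvsType R).
Hypothesis hausE : hausdorff_space E.
Implicit Types (B W : set E).

Lemma jet_smooth_curve (J : nat -> R -> E) :
  (forall r t, has_deriv (J r) t (J r.+1 t)) -> smooth_curve (J 0%N).
Proof.
move=> dJ.
have eJ r : curve_deriven r (J 0%N) = J r.
  elim: r => // r IH; rewrite /curve_deriven iterS -/(curve_deriven r _) IH.
  by apply/funext => t; exact: curve_deriveE.
by move=> n j _ t; rewrite eJ; apply: (@has_deriv_derivable _ _ _ _ (J j.+1 t)).
Qed.

Lemma eq_sum_eventually0 (F : nat -> E) N M : (forall n, (N <= n)%N -> F n = 0) ->
  (forall n, (M <= n)%N -> F n = 0) -> \sum_(n < N) F n = \sum_(n < M) F n.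
Proof.
wlog NM : N M / (N <= M)%N.
  move=> H FN FM; have [NM|MN] := leqP N M; first exact: H.
  by apply/esym/H => //; exact: ltnW.
move=> FN _; rewrite -!(big_mkord xpredT F) (big_cat_nat (leq0n N) NM) /=.
by rewrite [X in _ = _ + X]big_nat_cond [X in _ = _ + X]big1 ?addr0// => n /andP[/andP[/FN]].
Qed.

Section Gluing.
Variables (Phi : nat -> nat -> R -> E) (B : set E) (H : nat -> R).
Let p n : R := 2^-1 ^+ n.
Hypothesis boundedB : vbounded B.
Hypothesis H0 : forall r, 0 <= H r.
Hypothesis dPhi : forall n r s, has_deriv (Phi n r) s (Phi n r.+1 s).
Hypothesis Phi_support : forall n r s, p n / 8 <= `|s - p n| -> Phi n r s = 0.
Hypothesis Phi_bound : forall n r s, (r <= n)%N -> dilation (H r * p n ^+ 2) B (Phi n r s).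

Let p_gt0 n : 0 < p n. Proof. by rewrite exprn_gt0. Qed.

Let p_half n k : (n < k)%N -> p k <= p n / 2.
Proof.
move=> nk; rewrite -(subnKC nk) /p exprD exprSr mulrC.
have : 2^-1 ^+ (k - n.+1) <= 1 :> R by rewrite exprn_ile1//; lra.
have : 0 <= 2^-1 ^+ n * 2^-1 :> R by rewrite mulr_ge0// exprn_ge0.
by move=> ? ?; rewrite ler_piMl.
Qed.

(** The sum of all [Phi n]. For [s > 0] the terms beyond the bound used here vanish at
    [s] because their supports lie too close to [0], and for [s <= 0] all terms vanish. *)
Definition glue r s : E := \sum_(n < (Num.truncn (4 / s)).+1) Phi n r s.

Let Phi_neg n r s : s <= 0 -> Phi n r s = 0.
Proof.
move=> s0; apply: Phi_support; have := p_gt0 n => pn.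
by rewrite ler0_norm; lra.
Qed.

Let Phi_far n r s : 0 < s -> (Num.truncn (4 / s) < n)%N -> Phi n r s = 0.
Proof.
move=> s0 sn; apply: Phi_support; have pn := p_gt0 n.
have sn' : 4 / s < n%:R.
  by apply: lt_le_trans (truncnS_gt (4 / s)) _; rewrite ler_nat.
have n2 : n%:R < 2 ^+ n :> R by rewrite -natrX ltr_nat ltn_expl.
have : 4 * p n <= s.
  have : 4 / s <= 2 ^+ n by rewrite ltW// (lt_trans sn').
  rewrite ler_pdivrMr// /p exprVn => h.
  by rewrite ler_pdivrMr ?exprn_gt0// mulrC.
by move=> ?; rewrite ger0_norm; lra.
Qed.

Let glueE r s N : (forall n, (N <= n)%N -> Phi n r s = 0) ->
  glue r s = \sum_(n < N) Phi n r s.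
Proof.
apply: (eq_sum_eventually0 (F := fun n => Phi n r s)) => // n sn.
have [s0|s0] := lerP s 0; first exact: Phi_neg.
exact: Phi_far.
Qed.

Let disjoint_support n k s : `|s - p n| < p n / 8 -> `|s - p k| < p k / 8 -> n = k.
Proof.
have wlogH n' k' : (n' < k')%N -> `|s - p n'| < p n' / 8 -> `|s - p k'| < p k' / 8 -> False.
  move=> /p_half nk; rewrite !ltr_norml => /andP[? ?] /andP[? ?].
  have := p_gt0 k'; have := p_gt0 n'; lra.
by case: (ltngtP n k) => // [nk sn sk|kn sn sk]; [case: (wlogH n k)|case: (wlogH k n)].
Qed.

Lemma glue_on n r s : `|s - p n| < p n / 8 -> glue r s = Phi n r s.
Proof.
move=> sn; have oth k : k != n -> Phi k r s = 0.
  move=> kn; apply: Phi_support; rewrite leNgt; apply: contra kn => sk.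
  exact/eqP/(disjoint_support sk sn).
rewrite (@glueE r s n.+1); last by move=> k nk; apply: oth; rewrite gtn_eqF.
rewrite big_ord_recr /= big1 ?add0r// => i _; apply: oth.
by rewrite ltn_eqF.
Qed.

Lemma glue_off r s : (forall n, p n / 8 <= `|s - p n|) -> glue r s = 0.
Proof. by move=> sn; rewrite /glue big1// => n _; exact: Phi_support. Qed.

Lemma glue_case r s : glue r s = 0 \/ exists2 n, `|s - p n| < p n / 8 & glue r s = Phi n r s.
Proof.
have [[n sn]|sn] := pselect (exists n, `|s - p n| < p n / 8).
  by right; exists n => //; exact: glue_on.
by left; apply: glue_off => n; rewrite leNgt; apply/negP => h; apply: sn; exists n.
Qed.

(** Away from [0] the sum is locally finite. On the support of [Phi n], which is
    around [p n], the bound by [p n ^+ 2] is one of order [s ^+ 2], whence the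
    derivative [0] at [0]. *)
Lemma has_deriv_glue r s : has_deriv (glue r) s (glue r.+1 s).
Proof.
have [->|s0] := eqVneq s 0.
  have g0 r' : glue r' 0 = 0 by rewrite /glue big1// => n _; exact: Phi_neg.
  rewrite g0 => W dW; have [b b0 Bb] := (vboundedP _).1 boundedB W dW.
  have Hb0 : 0 < 2 * H r * b + 1.
    by rewrite ltr_wpDl// !mulr_ge0// ltW.
  exists (Num.min (2^-1 * p r) (2 * H r * b + 1)^-1).
    by rewrite lt_min mulr_gt0// invr_gt0.
  move=> h; rewrite lt_min => /andP[hr hb]; rewrite add0r g0 scaler0 !subr0.
  have [->|[n hn ->]] := glue_case r h; first exact: dilation0 dW.1 _.
  have pn := p_gt0 n; have pr := p_gt0 r.
  move: hn; rewrite ltr_norml => /andP[hn1 hn2].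
  have h0 : 0 < h by lra.
  rewrite gtr0_norm// in hr hb.
  have rn : (r <= n)%N.
    rewrite leqNgt; apply/negP => /p_half; lra.
  have := dilation_dilation (dilationS Bb (Phi_bound h rn)).
  apply: (dilation_ge0_le dW.1); first by rewrite !mulr_ge0 ?exprn_ge0// ltW.
  have p2 : p n ^+ 2 <= 2 * h ^+ 2.
    have : p n <= 8 / 7 * h by lra.
    move=> ph; have : p n ^+ 2 <= (8 / 7 * h) ^+ 2 by rewrite lerXn2r// ?nnegrE; lra.
    rewrite exprMn; have : 0 <= h ^+ 2 by rewrite exprn_ge0// ltW.
    by lra.
  apply: (@le_trans _ _ (H r * (2 * h ^+ 2) * b)).
    by apply: ler_wpM2r; [exact: ltW|exact: ler_wpM2l].
  have -> : H r * (2 * h ^+ 2) * b = h * (h * (2 * H r * b)) by ring.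
  apply: ler_piMr; first exact: ltW.
  have : h * (2 * H r * b + 1) < 1 by rewrite -ltr_pdivlMr// div1r.
  by lra.
have ns : 0 < `|s| by rewrite normr_gt0.
pose N := (Num.truncn (8 / `|s|)).+1.
have near r' s' : `|s' - s| < `|s| / 2 -> glue r' s' = \sum_(n < N) Phi n r' s'.
  move=> ss; apply: glueE => n Nn.
  have [s0'|s0'] := lerP s' 0; first exact: Phi_neg.
  apply: Phi_far => //; apply: leq_trans Nn; rewrite ltnS.
  apply: le_truncn.
  have sp : 0 < s.
    move: ss; rewrite ltr_norml; have [|?|?] := ltgtP s 0 => //.
      by move=> ?; rewrite ltr0_norm//; lra.
    by lra.
  move: ss; rewrite (gtr0_norm sp) ltr_norml => /andP[? ?].
  by rewrite ler_pdivrMr// mulrAC ler_pdivlMr//; lra.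
apply: (has_deriv_near (e := `|s| / 2) _ (near r)); first by rewrite divr_gt0.
rewrite near ?subrr ?normr0 ?divr_gt0//.
exact: has_deriv_sum.
Qed.

End Gluing.

(** The [n]-th arc, a polynomial in Newton form around [x], is run through with speed
    [sigma n], multiplied by a bump function of width [2^-1 ^+ n / 8] and placed
    around the time [2^-1 ^+ n]. The speed is so small compared to the width that all
    derivatives of the [n]-th piece decrease like [4 ^- n]. The rates [sigma] and
    [delta] do not depend on the arcs, which can therefore be selected afterwards,
    violating a given bound by a margin that beats the powers of [sigma n]. *)
Lemma special_curve (B : set E) (m : nat) (K kappa : R) :
  disk B -> vbounded B -> 0 < K -> 0 < kappa ->
  exists sigma delta : nat -> R, (forall n, 0 < delta n <= sigma n) /\
    forall (x : E) (T : nat -> seq R) (a : nat -> nat -> E),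
    (forall n, size (T n) = m.+1 /\ forall v, v \in T n -> `|v| <= delta n) ->
    (forall n, dilation (K * delta n) B (a n 0%N)) ->
    (forall n i, (i <= m)%N -> dilation K B (a n i)) ->
    exists c, [/\ smooth_curve c, forall t, dilation kappa B (c t - x) &
      forall n u, `|u| <= delta n -> c (2^-1 ^+ n + u / sigma n) =
        x + \sum_(i < m.+1) (\prod_(v <- take i (T n)) (u - v)) *: a n i].
Proof.
move=> dB bB K0 kappa0.
have [chi [jchi chi1 chi0 bchi]] := bump_jet R.
have /choice[C HC] : forall kr : nat * nat, exists C, 0 <= C /\ forall T y, size T = kr.1 ->
    (forall d, d \in T -> `|d| <= 1) -> `|jet_prod chi T kr.2 y| <= C.
  by move=> [k r]; have [C C0 HC] := jet_prod_bounded chi0 bchi k r; exists C.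
pose CC r := \sum_(k < m.+1) C (nat_of_ord k, r).
have CC0 r : 0 <= CC r by apply: sumr_ge0 => k _; exact: (HC _).1.
have CCP r T y : (size T <= m)%N -> (forall d, d \in T -> `|d| <= 1) ->
    `|jet_prod chi T r y| <= CC r.
  move=> sT dT; apply: le_trans ((HC (size T, r)).2 T y erefl dT) _.
  have sT' : (size T < m.+1)%N by [].
  rewrite /CC (bigD1 (Ordinal sT')) //= lerDl.
  by apply: sumr_ge0 => k _; exact: (HC _).1.
pose p n : R := 2^-1 ^+ n; pose w n := p n / 8.
(* with this factor all pieces have values in [kappa B] *)
pose kappa' := kappa / (m.+1%:R * K * CC 0%N + kappa + 1).
have K0' := ltW K0.
have hk : 0 <= m.+1%:R * K * CC 0%N by rewrite !mulr_ge0.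
have den0 : 0 < m.+1%:R * K * CC 0%N + kappa + 1 by lra.
have kappa'0 : 0 < kappa' by rewrite divr_gt0.
have kappa'1 : kappa' <= 1 by rewrite /kappa' ler_pdivrMr// mul1r; lra.
have p0 n : 0 < p n by rewrite exprn_gt0.
have p1 n : p n <= 1 by rewrite exprn_ile1//; lra.
have w0 n : 0 < w n by rewrite divr_gt0.
have w1 n : w n <= 1 by rewrite /w; have := p1 n; have := p0 n; lra.
pose sigma n := kappa' * w n ^+ n * p n ^+ 2.
pose delta n := sigma n * w n / 2.
have sigma0 n : 0 < sigma n.
  apply: mulr_gt0; last by rewrite exprn_gt0.
  by apply: mulr_gt0 => //; rewrite exprn_gt0.
have sigma1 n : sigma n <= 1.
  have wn : 0 <= w n ^+ n by rewrite exprn_ge0// ltW.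
  have pn : 0 <= p n ^+ 2 by rewrite exprn_ge0// ltW.
  have wn1 : w n ^+ n <= 1 by rewrite exprn_ile1// ltW.
  have pn1 : p n ^+ 2 <= 1 by rewrite exprn_ile1// ltW.
  have kw0 : 0 <= kappa' * w n ^+ n by rewrite mulr_ge0// ltW.
  by apply: mulr_ile1 => //; apply: mulr_ile1 => //; exact: ltW.
have sw0 n : 0 < sigma n * w n by rewrite mulr_gt0.
have swn n : sigma n * w n <= sigma n by rewrite ler_piMr// ltW.
have delta0 n : 0 < delta n by rewrite divr_gt0.
have delta_sigma n : delta n <= sigma n.
  by rewrite /delta; have := swn n; have := sw0 n; lra.
exists sigma, delta; split=> [n|x T a TP a0 aK]; first by rewrite delta0 delta_sigma.
pose L n i := [seq v / (sigma n * w n) | v <- take i (T n)].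
have sL n i : (i <= m)%N -> size (L n i) = i.
  by move=> im; rewrite size_map size_takel// (TP n).1 leqW.
have L1 n i d : d \in L n i -> `|d| <= 1.
  move=> /mapP[v /mem_take vT ->]; rewrite normrM normfV (gtr0_norm (sw0 n)).
  rewrite ler_pdivrMr// mul1r (le_trans ((TP n).2 v vT))// /delta.
  by have := sw0 n; lra.
pose Phi n r s := \sum_(i < m.+1) ((sigma n * w n) ^+ i * w n ^- r) *:
  (jet_prod chi (L n i) r ((w n)^-1 * s + - 8) *: a n i).
have dPhi n r s : has_deriv (Phi n r) s (Phi n r.+1 s).
  apply: has_deriv_sum => i.
  have -> : (sigma n * w n) ^+ i * w n ^- r.+1 *: (jet_prod chi (L n i) r.+1 ((w n)^-1 * s - 8) *: a n i) =
    ((sigma n * w n) ^+ i * w n ^- r) *: ((w n)^-1 *: (jet_prod chi (L n i) r.+1 ((w n)^-1 * s - 8) *: a n i)).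
    rewrite !scalerA; congr (_ *: _).
    by rewrite exprSr invfM; ring.
  apply: has_derivZ.
  apply: (has_deriv_affine (c := fun y => jet_prod chi (L n i) r y *: a n i)).
  apply: has_deriv_scalar; exact: jet_prodP.
have pw n : p n = 8 * w n by rewrite /w; lra.
have supp n r s : p n / 8 <= `|s - p n| -> Phi n r s = 0.
  move=> hs; rewrite /Phi big1// => i _.
  rewrite jet_prod_support ?scale0r ?scaler0// => r'; apply: chi0.
  have -> : (w n)^-1 * s - 8 = (s - p n) / w n by rewrite pw; field; rewrite gt_eqF.
  by rewrite normrM normfV (gtr0_norm (w0 n)) ler_pdivlMr// mul1r.
pose H r := m.+1%:R * K * CC r * kappa'.
have k0' := ltW kappa'0.
have p2 n : 0 <= p n ^+ 2 by rewrite exprn_ge0// ltW.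
have KC r : 0 <= K * CC r by rewrite mulr_ge0.
have KCk r : 0 <= K * CC r * kappa' by exact: mulr_ge0.
have H0 r : 0 <= H r by rewrite /H -!mulrA mulr_ge0// mulrA.
have bound n r s : (r <= n)%N -> dilation (H r * p n ^+ 2) B (Phi n r s).
  move=> rn.
  have -> : H r * p n ^+ 2 = \sum_(i < m.+1) K * CC r * kappa' * p n ^+ 2.
    by rewrite sumr_const card_ord -mulr_natl /H; ring.
  have t0 : 0 <= K * CC r * kappa' * p n ^+ 2 by exact: mulr_ge0.
  apply: dilation_sum => // i _; rewrite scalerA.
  have im : (i <= m)%N by rewrite -ltnS.
  have sw : sigma n * w n ^- r <= kappa' * p n ^+ 2.
    have -> : sigma n * w n ^- r = kappa' * p n ^+ 2 * w n ^+ (n - r).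
      have -> : sigma n = kappa' * (w n ^+ r * w n ^+ (n - r)) * p n ^+ 2.
        by rewrite -exprD subnKC.
      by field; rewrite expf_neq0// gt_eqF.
    apply: ler_piMr; first exact: mulr_ge0.
    by apply: exprn_ile1 => //; exact: ltW.
  have [q [Bq q0 qs]] : exists q, [/\ dilation (K * q) B ((sigma n * w n) ^+ i *: a n i), 0 <= q & q <= sigma n].
    case: (nat_of_ord i) im => [|j] jm.
      by exists (delta n); split; [rewrite expr0 scale1r|exact: ltW|].
    exists ((sigma n * w n) ^+ j.+1); split.
    - by rewrite mulrC; apply: dilationZ; exact: aK.
    - by rewrite exprn_ge0// ltW.
    - apply: le_trans (swn n); rewrite exprS; apply: ler_piMr; first exact: ltW.
      by apply: exprn_ile1; [exact: ltW|exact: le_trans (swn n) _].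
  set jp := jet_prod _ _ _ _.
  have -> : ((sigma n * w n) ^+ i * w n ^- r * jp) *: a n i =
      (w n ^- r * jp) *: ((sigma n * w n) ^+ i *: a n i).
    by rewrite scalerA; congr (_ *: _); ring.
  apply: (dilation_le dB) (dilationZ _ Bq).
  have jC : `|jp| <= CC r by apply: CCP; [rewrite sL|exact: L1].
  have wr : 0 <= w n ^- r by rewrite invr_ge0 exprn_ge0// ltW.
  have Kq : 0 <= K * q by exact: mulr_ge0.
  rewrite [leRHS]ger0_norm // !normrM (ger0_norm wr) (ger0_norm K0') (ger0_norm q0).
  have -> : w n ^- r * `|jp| * (K * q) = `|jp| * (K * (q * w n ^- r)) by ring.
  apply: (@le_trans _ _ (CC r * (K * (sigma n * w n ^- r)))).
    apply: ler_pM => //; first by rewrite mulr_ge0// mulr_ge0.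
    by rewrite ler_wpM2l// ler_wpM2r.
  have -> : K * CC r * kappa' * p n ^+ 2 = CC r * (K * (kappa' * p n ^+ 2)) by ring.
  by rewrite ler_wpM2l// ler_wpM2l.
pose J r t := if r is 0%N then x + glue Phi 0 t else glue Phi r t.
exists (J 0%N); split.
- apply: jet_smooth_curve => -[|r] t /=; last exact: has_deriv_glue bound _ _.
  rewrite -[glue _ _ _]add0r; apply: has_derivD; first exact: has_deriv_cst.
  exact: has_deriv_glue bound _ _.
- move=> t; rewrite /J addrAC subrr add0r.
  have [->|[n _ ->]] := glue_case supp 0 t; first exact: dilation0.
  apply: (dilation_ge0_le dB) (bound n 0%N t (leq0n n)); first exact: mulr_ge0.
  apply: (@le_trans _ _ (H 0%N)).
    by rewrite ler_piMr// exprn_ile1// ltW.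
  rewrite /H /kappa' mulrA ler_pdivrMr// [leRHS]mulrC ler_pM2r//; lra.
- move=> n u un /=; congr (_ + _).
  have us : `|2^-1 ^+ n + u / sigma n - p n| < p n / 8.
    rewrite -/(p n) addrAC subrr add0r normrM normfV (gtr0_norm (sigma0 n)).
    rewrite ltr_pdivrMr// (le_lt_trans un)// /delta -/(w n) [ltRHS]mulrC.
    by have := sw0 n; lra.
  rewrite (glue_on supp _ us) /Phi; apply: eq_bigr => i _.
  have im : (i <= m)%N by rewrite -ltnS.
  have sn0 : sigma n != 0 by rewrite gt_eqF.
  have wn0 : w n != 0 by rewrite gt_eqF.
  have -> : (w n)^-1 * (2^-1 ^+ n + u / sigma n) - 8 = u / (sigma n * w n).
    by rewrite -/(p n) pw; field; rewrite wn0 sn0.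
  rewrite jet_prod0 chi1; last first.
    rewrite normrM normfV (gtr0_norm (sw0 n)) ler_pdivrMr// mulrC.
    exact: un.
  rewrite mulr1 expr0 invr1 mulr1 scalerA; congr (_ *: _).
  rewrite big_map.
  have <- : \prod_(v <- take i (T n)) (sigma n * w n) = (sigma n * w n) ^+ i.
    by rewrite big_const_seq count_predT iter_mulr_1 size_takel// (TP n).1 leqW.
  rewrite -big_split /=; apply: eq_bigr => v _.
  by field; rewrite wn0 sn0.
Qed.

End SpecialCurve.

(** * From local to uniform bounds *)

Section LocalBounds.
Variables (R : realType) (E : tvsType R).
Implicit Types (W : set E) (T : seq R) (c : R -> E) (J K : set R).

Definition interval_around (s e : R) : set R := [set t | `|t - s| <= e].

Lemma nodesS J K m T : J `<=` K -> nodes J m T -> nodes K m T.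
Proof. by move=> JK [uT sT TJ]; split => // t /TJ /JK. Qed.

(** A sequence of node lists that violates the bound more and more has heads that
    cluster at some point [s]. Either all nodes of some late member are close to [s],
    or two of its nodes are apart; both alternatives are excluded by a bound. *)
Lemma nodes_uniform_bound (F : seq R -> E) W a e m :
  disk_nbhs W ->
  (forall s, interval_around a e s -> exists d r : R, 0 < d /\
    forall T, nodes (interval_around s d `&` interval_around a e) m T -> dilation r W (F T)) ->
  (forall rho : R, 0 < rho -> exists r : R, forall T, nodes (interval_around a e) m T ->
    (exists u v, [/\ u \in T, v \in T & rho <= `|u - v|]) -> dilation r W (F T)) ->
  exists2 r : R, 0 < r & forall T, nodes (interval_around a e) m T -> dilation r W (F T).
Proof.
move=> dW near far; apply: contrapT => nb.
have bad (n : nat) : exists T, nodes (interval_around a e) m T /\ ~ dilation n.+1%:R W (F T).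
  apply: contrapT => nt; apply: nb; exists n.+1%:R => // T nT.
  by apply: contrapT => nW; apply: nt; exists T.
have [T Tbad] := choice bad.
have hT n : exists2 t, t \in T n & interval_around a e t.
  have [[_ sT TJ] _] := Tbad n; case: (T n) sT TJ => [//|t T'] _ TJ.
  by exists t; [exact: mem_head|apply: TJ; exact: mem_head].
have [x xT] := choice (fun n => let: ex_intro2 t tT tJ := hT n in
  ex_intro (fun t => t \in T n /\ interval_around a e t) t (conj tT tJ)).
have [s sJ cl] : exists2 s, a - e <= s <= a + e & forall d N, 0 < d ->
    exists2 n, (N <= n)%N & `|x n - s| < d.
  apply: segment_cluster => n; have := (xT n).2; rewrite /interval_around /= ler_norml.
  by move=> /andP[? ?]; apply/andP; split; lra.
have [|d [r [d0 dr]]] := near s.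
  by rewrite /interval_around /= ler_norml; case/andP: sJ => ? ?; apply/andP; split; lra.
have d2 : 0 < d / 2 by rewrite divr_gt0.
have [r' far'] := far _ d2.
have [n Nn xn] := cl _ (maxn (Num.truncn `|r|) (Num.truncn `|r'|)).+1 d2.
have [nT nW] := Tbad n.
have le_n (z : R) : (Num.truncn `|z| < n)%N -> `|z| <= `|n.+1%:R|.
  move=> zn; rewrite normr_nat ltW// (lt_trans (truncnS_gt `|z|))// ltr_nat.
  by rewrite ltnS (leq_trans zn).
have rn : `|r| <= `|n.+1%:R| by apply: le_n; apply: leq_trans Nn; rewrite ltnS leq_maxl.
have rn' : `|r'| <= `|n.+1%:R| by apply: le_n; apply: leq_trans Nn; rewrite ltnS leq_maxr.
have [[u [uT un]]|close] := pselect (exists u, u \in T n /\ d / 2 <= `|u - x n|).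
  apply: nW; apply: (dilation_le dW.1 rn'); apply: far' => //.
  by exists u, (x n); split => //; exact: (xT n).1.
apply: nW; apply: (dilation_le dW.1 rn); apply: dr.
case: nT => uT sT TJ; split => // t tT; split; last exact: TJ.
have tx : `|t - x n| < d / 2 by rewrite ltNge; apply/negP => h; apply: close; exists t.
by rewrite /interval_around /= -(subrK (x n) t) -addrA (le_trans (ler_normD _ _))//; lra.
Qed.

(** This disposes of node lists that do not shrink to a point: the recursion with
    respect to two distant nodes has a bounded denominator. *)
Lemma ddiff_far J m c W (r rho : R) T u v : disk W -> 0 <= r -> 0 < rho ->
  (forall S, nodes J m S -> dilation r W (ddiff c S)) ->
  nodes J m.+1 T -> u \in T -> v \in T -> rho <= `|u - v| ->
  dilation (rho^-1 * (r + r)) W (ddiff c T).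
Proof.
move=> dW r0 rho0 cW [uT sT TJ] uTm vTm uv.
have uv0 : u != v by apply: contraTneq uv => ->; rewrite subrr normr0 -ltNge.
have vT' : v \in rem u T by rewrite mem_rem_uniq// inE eq_sym uv0 vTm.
pose T' := rem v (rem u T).
have pT : perm_eq T [:: u, v & T'].
  by rewrite (perm_trans (perm_to_rem uTm))// perm_cons perm_to_rem.
have uT' : uniq [:: u, v & T'] by rewrite -(perm_uniq pT).
have sT' : size T' = m by have := perm_size pT; rewrite sT /= => -[].
have nodes' w : w \in T -> w \notin T' -> nodes J m (w :: T').
  move=> wT wT'; split; [|by rewrite /= sT'|].
    by rewrite /= wT'; move: uT' => /= /andP[_ /andP[_ ->]].
  move=> t; rewrite inE => /orP[/eqP->|tT']; first exact: TJ.
  by apply: TJ; rewrite (perm_mem pT) !inE tT' !orbT.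
rewrite (ddiff_perm _ uT pT) ddiff_cons2//.
have uvT : u \notin T' /\ v \notin T'.
  by move: uT'; rewrite /= inE negb_or -andbA => /and4P[].
have := dilationB dW r0 r0 (cW _ (nodes' v vTm uvT.2)) (cW _ (nodes' u uTm uvT.1)).
move=> /(dilationZ (v - u)^-1); apply: (dilation_le dW).
have rr : 0 <= r + r by exact: addr_ge0.
rewrite !normrM ler_wpM2r// normfV normfV [`|rho|]gtr0_norm// lef_pV2 ?posrE//.
  by rewrite distrC.
by rewrite normr_gt0 subr_eq0 eq_sym.
Qed.

Lemma segment_ballE (N : R) : segment_ball N = interval_around 0 N.
Proof. by apply/seteqP; split=> t; rewrite /segment_ball /interval_around /= subr0. Qed.

Lemma ddiff_bounded_from_local m c :
  (m = 0%N \/ locally_ddiff_bounded m.-1 c) ->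
  (forall s, exists2 d : R, 0 < d & ddiff_bounded (interval_around s d) m c) ->
  locally_ddiff_bounded m c.
Proof.
move=> lowc locc N; apply/ddiff_boundedP => W dW; rewrite segment_ballE.
apply: (nodes_uniform_bound (F := ddiff c)) => // [s _|rho rho0].
  have [d d0 /ddiff_boundedP /(_ W dW)[r _ rW]] := locc s.
  by exists d, r; split => // T nT; apply: rW; apply: nodesS nT => t [].
case: lowc => [->|lowc].
  exists 0 => -[|t [|? ?]] [_ sT _] // [u [v]]; rewrite !inE => -[/eqP-> /eqP->].
  by rewrite subrr normr0 leNgt rho0.
case: m lowc {locc} => [|m] lowc.
  exists 0 => -[|t [|? ?]] [_ sT _] // [u [v]]; rewrite !inE => -[/eqP-> /eqP->].
  by rewrite subrr normr0 leNgt rho0.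
have [r r0 rW] := (ddiff_boundedP _ _ _).1 (lowc N) W dW.
exists (rho^-1 * (r + r)) => T nT [u [v [uT vT uv]]].
rewrite -segment_ballE in nT.
exact: (ddiff_far dW.1 (ltW r0) rho0 rW nT uT vT uv).
Qed.

End LocalBounds.

(** * Inverting a perturbation of the identity *)

Section Inversion.
Variables (R : realType) (E : tvsType R) (BB : set (set E)) (y0 : E) (g : E -> E).
Hypothesis hausE : hausdorff_space E.
Hypothesis lcE : locally_complete E.
Hypothesis genBB : bornological_generator BB.
Implicit Types (A B W : set E) (x y z : E) (r s t : R).

(** [g - id] contracts by [1 / 2] on each [y0 + 2 B] with respect to the norm
    whose unit ball is [B]. *)
Definition half_contraction := forall B x x' r, BB B -> 0 <= r ->
  dilation 2 B (x - y0) -> dilation 2 B (x' - y0) -> dilation r B (x' - x) ->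
  dilation (r / 2) B (g x' - g x - (x' - x)).

Hypothesis contr : half_contraction.

Lemma generator_disk B : BB B -> [/\ disk B, closed B & vbounded B].
Proof.
move=> /(let: And3 h _ _ := genBB in h _) [[b Bb] bB clB aB]; split => //; split => //.
by have := aB 0 0 b b; rewrite normr0 addr0 !scale0r addr0; apply.
Qed.

Lemma generator_absorbs A : vbounded A -> exists B r, [/\ BB B, 0 < r & A `<=` dilation r B].
Proof.
move=> /(let: And3 _ _ h := genBB in h _) [t [B [t0 BBB At]]]; exists B, t; split => //.
by move=> x /At[b Bb <-]; exists b.
Qed.

(** Since the generator is directed, any bounded set can be absorbed by a member that
    contains a given one; this lets a single norm serve for all data at hand. *)
Lemma generator_enlarge B A : BB B -> vbounded A ->
  exists C r, [/\ BB C, B `<=` C, 0 < r & A `<=` dilation r C].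
Proof.
move=> BBB /generator_absorbs[B' [r [BBB' r0 Ar]]].
have [C BBC BC] := let: And3 _ h _ := genBB in h B B' BBB BBB'.
exists C, r; split => //; first by move=> x Bx; apply: BC; left.
by move=> x /Ar; apply: dilationS => y By; apply: BC; right.
Qed.

(** The strict inequality [s < 2] leaves room for the small displacements in the
    definition of Mackey openness. *)
Definition tame_domain : set E :=
  [set x | exists B s, [/\ BB B, 0 <= s, s < 2 & dilation s B (x - y0)]].

(** The factor [3] instead of the optimal [2] spares a passage to the limit. *)
Lemma expanding B x x' r : BB B -> 0 < r ->
  dilation 2 B (x - y0) -> dilation 2 B (x' - y0) -> dilation r B (g x' - g x) ->
  dilation (3 * r) B (x' - x).
Proof.
move=> BBB r0 Bx Bx' Bg; have [dB _ _] := generator_disk BBB.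
(* a bound [r] for the increment of [g] and a bound [q] for that of [id] improve
   the latter to [r + q / 2] *)
have step n : dilation (2 * r + 4 * 2^-1 ^+ n) B (x' - x).
  elim: n => [|n IH].
    rewrite expr0 mulr1; have := dilationB dB (ler0n R 2) (ler0n R 2) Bx' Bx.
    rewrite opprB subrKA; apply: (dilation_ge0_le dB); lra.
  have pn : 0 <= 2^-1 ^+ n :> R by rewrite exprn_ge0.
  have q0 : 0 <= 2 * r + 4 * 2^-1 ^+ n by lra.
  have := dilationB dB (ltW r0) (divr_ge0 q0 (ler0n R 2)) Bg (contr BBB q0 Bx Bx' IH).
  rewrite opprB addrCA subrr addr0; apply: (dilation_ge0_le dB).
    by rewrite addr_ge0 ?divr_ge0// ltW.
  by rewrite exprS; lra.
have [n _ n4] := pow2_small r0.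
apply: (dilation_ge0_le dB) (step n); last by lra.
by have : 0 <= 2^-1 ^+ n :> R; [rewrite exprn_ge0|lra].
Qed.

Lemma lipschitz B x x' r : BB B -> 0 <= r ->
  dilation 2 B (x - y0) -> dilation 2 B (x' - y0) -> dilation r B (x' - x) ->
  dilation (2 * r) B (g x' - g x).
Proof.
move=> BBB r0 Bx Bx' Br; have [dB _ _] := generator_disk BBB.
have r2 : 0 <= r / 2 by rewrite divr_ge0.
have := dilationD dB r2 r0 (contr BBB r0 Bx Bx' Br) Br.
rewrite subrK; apply: (dilation_ge0_le dB); lra.
Qed.

Lemma tame_domain_common x x' : tame_domain x -> tame_domain x' ->
  exists B, [/\ BB B, dilation 2 B (x - y0) & dilation 2 B (x' - y0)].
Proof.
move=> [B [s [BBB s0 s2 Bx]]] [B' [s' [BBB' s0' s2' Bx']]].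
have [C BBC BC] := let: And3 _ h _ := genBB in h B B' BBB BBB'.
have [dC _ _] := generator_disk BBC.
exists C; split => //.
- apply: (dilation_ge0_le dC s0 (ltW s2)); apply: dilationS Bx => y By.
  by apply: BC; left.
- apply: (dilation_ge0_le dC s0' (ltW s2')); apply: dilationS Bx' => y By.
  by apply: BC; right.
Qed.

Lemma tame_domain_inj x x' : tame_domain x -> tame_domain x' -> g x = g x' -> x = x'.
Proof.
move=> Ux Ux' e; have [B [BBB Bx Bx']] := tame_domain_common Ux Ux'.
have [dB _ bB] := generator_disk BBB.
apply/esym/eqP; rewrite -subr_eq0; apply/eqP; apply: (dilation_small_eq0 hausE dB bB) => r r0.
have r3 : 0 < r / 3 by rewrite divr_gt0.
have -> : r = 3 * (r / 3) by field.
by apply: expanding => //; rewrite e subrr; exact: dilation0.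
Qed.

(** Solutions are limits of the iteration [y |-> y + (z - g y)] started at [x]. *)
Lemma solve B x z s r : BB B -> 0 <= s -> 0 < r -> s + 3 * r <= 2 ->
  dilation s B (x - y0) -> dilation r B (z - g x) ->
  exists2 y, dilation (3 * r) B (y - x) & g y = z.
Proof.
move=> BBB s0 r0 sr Bx Bz; have [dB clB bB] := generator_disk BBB.
pose y n := iter n (fun y => y + (z - g y)) x.
have yS n : y n.+1 = y n + (z - g (y n)) by [].
have pn n : 0 <= 2^-1 ^+ n :> R by rewrite exprn_ge0.
have rp n : 0 <= r * 2^-1 ^+ n by rewrite mulr_ge0// ltW.
have in2 v : dilation (2 * r) B (v - x) -> dilation 2 B (v - y0).
  move=> Bv; have r2 : 0 <= 2 * r by lra.
  have := dilationD dB r2 s0 Bv Bx; rewrite subrKA.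
  by apply: (dilation_ge0_le dB); lra.
(* the defect halves at each step, and it is also the next increment *)
have inv n : dilation (r * 2^-1 ^+ n) B (z - g (y n)) /\
    dilation (2 * r - 2 * (r * 2^-1 ^+ n)) B (y n - x).
  elim: n => [|n [IHz IHx]].
    by rewrite expr0 mulr1 !subrr; split => //; exact: dilation0.
  have p1 : r * 2^-1 ^+ n <= r by rewrite ler_piMr ?exprn_ile1//; lra.
  have rn := rp n.
  have IHx0 : 0 <= 2 * r - 2 * (r * 2^-1 ^+ n) by lra.
  have Bx1 : dilation (2 * r - 2 * (r * 2^-1 ^+ n.+1)) B (y n.+1 - x).
    have := dilationD dB IHx0 (rp n) IHx IHz.
    rewrite yS [y n + _ - x]addrAC; apply: (dilation_ge0_le dB); first lra.
    by rewrite exprS; lra.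
  split=> //.
  have h1 : dilation 2 B (y n - y0).
    by apply: in2; apply: (dilation_ge0_le dB) IHx; lra.
  have h2 : dilation 2 B (y n.+1 - y0).
    apply: in2; apply: (dilation_ge0_le dB) Bx1; rewrite exprS; lra.
  have := contr BBB (rp n) h1 h2; rewrite yS [y n + _ - y n]addrAC subrr add0r => /(_ IHz).
  move=> /(dilationN dB); rewrite opprB opprB subrKA.
  by rewrite exprS mulrCA [2^-1 * _]mulrC.
have dB' : disk (dilation r B) by exact: disk_dilation.
have [|n|v vy] := @Mackey_limit _ _ (dilation r B) y lcE _ dB' (vbounded_dilation r bB).
- exact: closed_dilation.
- have [b Bb e] := (inv n).1; exists (r *: b); first by exists b.
  by rewrite yS addrAC subrr add0r e scalerA mulrC.
have vx : dilation (3 * r) B (v - x).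
  by have := dilation_dilation (vy 0%N); rewrite expr0 mulr1.
exists v => //.
apply/eqP; rewrite -subr_eq0; apply/eqP; apply: (dilation_small_eq0 hausE dB bB) => e e0.
have e8 : 0 < e / (2 * r) by rewrite divr_gt0// mulr_gt0.
have [n _ n4] := pow2_small e8.
have v2 : dilation 2 B (v - y0).
  have r3 : 0 <= 3 * r by lra.
  have := dilationD dB r3 s0 vx Bx; rewrite subrKA.
  by apply: (dilation_ge0_le dB); lra.
have y2 : dilation 2 B (y n - y0).
  apply: in2; apply: (dilation_ge0_le dB) (inv n).2; last by have := rp n; lra.
  have : r * 2^-1 ^+ n <= r by rewrite ler_piMr ?exprn_ile1//; lra.
  by lra.
have r3n : 0 <= 3 * 2^-1 ^+ n * r by rewrite mulr_ge0 ?mulr_ge0// ltW.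
have := dilationB dB _ (rp n) (lipschitz BBB r3n y2 v2 (dilation_dilation (vy n))) (inv n).1.
rewrite opprB subrKA => /(_ (mulr_ge0 (ler0n R 2) r3n)).
move: n4; rewrite ltr_pdivlMr ?mulr_gt0// => n4.
apply: (dilation_ge0_le dB); first by have := rp n; lra.
by have := rp n; lra.
Qed.

Lemma tame_domain_solve x A : tame_domain x -> vbounded A -> exists2 d : R, 0 < d &
  forall t, 0 <= t <= d -> forall a, A a -> exists2 y, tame_domain y & g y = g x + t *: a.
Proof.
move=> [B0 [s [BBB0 s0 s2 Bx0]]] bA.
have [B [r [BBB BC r0 Ar]]] := generator_enlarge BBB0 bA.
have [dB _ _] := generator_disk BBB.
have Bx := dilationS BC Bx0.
exists ((2 - s) / (6 * r)); first by rewrite divr_gt0 ?mulr_gt0; lra.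
move=> t /andP[t0 td] a Aa.
have tr : t * r <= (2 - s) / 6.
  have -> : (2 - s) / 6 = (2 - s) / (6 * r) * r by field; rewrite gt_eqF.
  by rewrite ler_wpM2r// ltW.
pose q := (2 - s) / 6; have q0 : 0 < q by rewrite /q; lra.
have Bz : dilation q B (g x + t *: a - g x).
  rewrite addrAC subrr add0r; apply: (dilation_ge0_le dB _ tr); last exact: dilationZ (Ar _ Aa).
  by rewrite mulr_ge0// ltW.
have [|y yx gy] := solve BBB s0 q0 _ Bx Bz; first by rewrite /q; lra.
exists y => //; exists B, (s + 3 * q); split => //.
- by rewrite /q; lra.
- by rewrite /q; lra.
- rewrite -(subrK x y) -addrA addrC; apply: (dilationD dB) => //; lra.
Qed.

Lemma mopen_tame_domain : mopen tame_domain.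
Proof.
move=> x A [B0 [s [BBB0 s0 s2 Bx0]]] bA.
have [B [r [BBB BC r0 Ar]]] := generator_enlarge BBB0 bA.
have [dB _ _] := generator_disk BBB.
exists ((2 - s) / (2 * r)); first by rewrite divr_gt0 ?mulr_gt0; lra.
move=> t /andP[t0 td] a Aa.
have tr : t * r <= (2 - s) / 2.
  have -> : (2 - s) / 2 = (2 - s) / (2 * r) * r by field; rewrite gt_eqF.
  by rewrite ler_wpM2r// ltW.
have tr0 : 0 <= t * r by rewrite mulr_ge0// ltW.
exists B, (s + t * r); split => //; [lra|lra|].
rewrite addrAC; apply: (dilationD dB) => //; first exact: dilationS Bx0.
exact: dilationZ (Ar _ Aa).
Qed.

Lemma tame_domain_center : tame_domain y0.
Proof.
have [B [r [BBB r0 _]]] := generator_absorbs (vbounded1 y0).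
have [dB _ _] := generator_disk BBB.
by exists B, 0; split => //; rewrite subrr; exact: dilation0.
Qed.

End Inversion.

(** * Uniform bounds along interpolation polynomials *)

Section NewtonNear.
Variables (R : realType) (E : tvsType R).
Hypothesis hausE : hausdorff_space E.
Variables (D : set E) (f : E -> E) (m : nat).
Hypothesis f_bounded : forall c, smooth_curve c -> (forall t, D (c t)) ->
  locally_ddiff_bounded m.+1 (f \o c).
Implicit Types (B W : set E) (x y z : E) (r s t u : R) (T : seq R).

(** The assertion that makes the interpolation argument uniform in the nodes. If it
    failed at [s], there would be node lists shrinking to [s] as fast as desired along
    which the divided differences of [f \o newton c T] exceed any prescribed growth.
    The corresponding arcs of the Newton polynomials converge to [c s] and lie on one
    smooth curve, and the divided differences of [f] along this curve are bounded. The
    affine change of time multiplies them by a power of the speed, which the growth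
    was chosen to beat. *)
Lemma newton_ddiff_near (c : R -> E) B K kappa s W :
  disk B -> vbounded B -> 0 < K -> 0 < kappa -> disk_nbhs W ->
  (forall x, dilation kappa B (x - c s) -> D x) ->
  forall J : set R,
  (forall t, J t -> dilation (K * `|t - s|) B (c t - c s)) ->
  (forall t, J t -> `|t - s| <= 1) ->
  (forall i T, (i <= m)%N -> nodes J i T -> dilation K B (ddiff c T)) ->
  exists e r : R, 0 < e /\
    forall T, nodes (interval_around s e `&` J) m.+1 T ->
      dilation r W (ddiff (f \o newton c (behead T)) T).
Proof.
move=> dB bB K0 kappa0 dW xD J Jlip J1 JK.
have [sigma [delta [sd curveP]]] := special_curve hausE m dB bB K0 kappa0.
apply: contrapT => nb.
have d0 n : 0 < delta n by case/andP: (sd n).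
have s0 n : 0 < sigma n by case/andP: (sd n) => /lt_le_trans; apply.
(* [sigma n ^- m.+1] is the effect of the change of speed on divided differences,
   and [n.+1] exceeds any bound valid along the resulting curve *)
have bad n : exists T, nodes (interval_around s (delta n) `&` J) m.+1 T /\
    ~ dilation ((sigma n)^-1 ^+ m.+1 * n.+1%:R) W (ddiff (f \o newton c (behead T)) T).
  apply: contrapT => nt; apply: nb; exists (delta n), ((sigma n)^-1 ^+ m.+1 * n.+1%:R).
  by split => // T nT; apply: contrapT => nW; apply: nt; exists T.
have [T Tbad] := choice bad.
pose T0 n := behead (T n).
have T0E n : exists t a T1, [/\ T n = [:: t, a & T1], size T1 = m,
    uniq (a :: T1) & forall v, v \in a :: T1 -> interval_around s (delta n) v /\ J v].
  have [[uT sT TJ] _] := Tbad n; case: (T n) uT sT TJ => [|t [|a T1]] // uT [sT] TJ.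
  exists t, a, T1; split => //; first by case/andP: uT.
  by move=> v vT; apply: TJ; rewrite inE vT orbT.
pose a n i := if i is 0%N then c (head 0 (T0 n)) - c s else ddiff c (take i.+1 (T0 n)).
have [||n i im|cv [cvs cvD cvE]] := curveP (c s) (fun n => [seq w - s | w <- T0 n]) a.
- move=> n; have [t [b [T1 [eT sT uT TJ]]]] := T0E n; split; first by rewrite size_map /T0 eT /= sT.
  by move=> v /mapP[w wT ->]; rewrite /T0 eT in wT; exact: (TJ w wT).1.
- move=> n; have [t [b [T1 [eT sT uT TJ]]]] := T0E n; rewrite /a /T0 eT /=.
  have [bs Jb] := TJ b (mem_head _ _).
  apply: (dilation_ge0_le dB) (Jlip b Jb); first by rewrite mulr_ge0// ltW.
  by rewrite ler_wpM2l// ltW.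
- have [t [b [T1 [eT sT uT TJ]]]] := T0E n; rewrite /a /T0 eT.
  case: i im => [|i] im.
    have [bs Jb] := TJ b (mem_head _ _).
    apply: (dilation_ge0_le dB) (Jlip b Jb); first by rewrite mulr_ge0// ltW.
    by rewrite ler_piMr ?J1// ltW.
  change (dilation K B (ddiff c (take i.+2 (b :: T1)))).
  apply: (JK i.+1) => //; have := @cat_take_drop i.+2 _ (b :: T1) => /= eq.
  split.
  - by move: uT; rewrite -eq -cat_cons cat_uniq => /and3P[].
  - by rewrite /= size_takel// sT.
  - by move=> v vT; apply: (TJ v _).2; rewrite -eq -cat_cons mem_cat vT.
have fcb : locally_ddiff_bounded m.+1 (f \o cv).
  by apply: f_bounded => // t; exact: xD.
have [r r0 rW] := (ddiff_boundedP _ _ _).1 (fcb 2) W dW.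
pose n := Num.truncn r.
have [t [b [T1 [eT sT uT TJ]]]] := T0E n; have [[uTn sTn TnJ] nW] := Tbad n.
apply: nW.
have -> : ddiff (f \o newton c (behead (T n))) (T n) =
    ddiff (fun v => (f \o cv) ((sigma n)^-1 * v + (2^-1 ^+ n - s / sigma n))) (T n).
  apply: eq_ddiff => v vT /=; congr f.
  have vd : `|v - s| <= delta n := (TnJ v vT).1.
  have -> : (sigma n)^-1 * v + (2^-1 ^+ n - s / sigma n) = 2^-1 ^+ n + (v - s) / sigma n by ring.
  rewrite cvE// -[in LHS](subrK s v) addrC eT [behead _]/= newton_shift /= sT.
  by rewrite /a /T0 eT /=; congr (_ + _); apply: eq_bigr => -[[|i] im] _.
rewrite ddiff_affine sTn /=; apply: (dilation_ge0_le dW.1); last first.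
- apply: dilationZ; apply: rW; split.
  - rewrite map_inj_uniq// => v w /addIr; apply: mulfI.
    by rewrite invr_eq0 gt_eqF.
  - by rewrite size_map.
  - move=> _ /mapP[v vT ->]; rewrite /segment_ball /=.
    have -> : (sigma n)^-1 * v + (2^-1 ^+ n - s / sigma n) = 2^-1 ^+ n + (v - s) / sigma n by ring.
    rewrite (le_trans (ler_normD _ _))//.
    have : `|2^-1 ^+ n| <= 1 :> R by rewrite ger0_norm ?exprn_ge0// exprn_ile1//; lra.
    have : `|(v - s) / sigma n| <= 1.
      rewrite normrM normfV (gtr0_norm (s0 n)) ler_pdivrMr// mul1r.
      by apply: le_trans (TnJ v vT).1 _; case/andP: (sd n).
    by lra.
- rewrite ler_wpM2l ?exprn_ge0 ?invr_ge0 ?ltW// truncnS_gt//.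
- by rewrite mulr_ge0 ?exprn_ge0 ?invr_ge0 ?ltW.
Qed.

End NewtonNear.

(** * The inverse along curves *)

Section InverseCurve.
Variables (R : realType) (E : tvsType R) (BB : set (set E)) (y0 : E).
Variables (D : set E) (f : E -> E) (L M : {linear E -> E}).
Hypothesis hausE : hausdorff_space E.
Hypothesis lcE : locally_complete E.
Hypothesis genBB : bornological_generator BB.
Hypotheses (contL : continuous L) (contM : continuous M) (MK : cancel M L).
Hypothesis contr : half_contraction BB y0 (M \o f).
Hypothesis BB_dom : forall B x, BB B -> dilation 2 B (x - y0) -> D x.
Implicit Types (A B W : set E) (x y z : E) (r s t u : R) (T : seq R).

Variable eta : R -> E.
Hypothesis eta_dom : forall t, tame_domain BB y0 (eta t).
Hypothesis feta_bounded : forall m, locally_ddiff_bounded m (f \o eta).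

(** The values [g (eta t)] move with bounded speed, so that for [t] close to [t0] the
    equation [g y = g (eta t)] is solvable close to [eta t0]. By injectivity the
    solution is [eta t], which therefore stays in one set [y0 + s B], where [g] is
    expanding. *)
Lemma eta_local t0 : exists B s d K, [/\ BB B, 0 <= s < 2, 0 < d, 0 < K &
  (forall t, interval_around t0 d t -> dilation s B (eta t - y0)) /\
  (forall t t', interval_around t0 d t -> interval_around t0 d t' ->
    dilation (K * `|t' - t|) B (eta t' - eta t))].
Proof.
have [B0 [s [BBB0 s0 s2 Bx0]]] := eta_dom t0.
have bA := vbounded_linear contM (feta_bounded 1 (`|t0| + 1)).
have [B [r [BBB BC r0 Ar]]] := generator_enlarge genBB BBB0 bA.
have [dB _ bB] := generator_disk genBB BBB.
have Bx := dilationS BC Bx0.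
have gB t t' : interval_around t0 1 t -> interval_around t0 1 t' ->
    dilation (r * `|t' - t|) B ((M \o f) (eta t') - (M \o f) (eta t)).
  move=> t1 t1'; have [->|tt] := eqVneq t' t.
    by rewrite !subrr; exact: dilation0.
  have near0 u : interval_around t0 1 u -> segment_ball (`|t0| + 1) u.
    rewrite /interval_around /segment_ball /= => ut.
    by rewrite -(subrK t0 u) addrC (le_trans (ler_normD _ _))// lerD2l.
  have nT : nodes (segment_ball (`|t0| + 1)) 1 [:: t; t'].
    split=> //; first by rewrite /= inE eq_sym tt.
    by move=> u; rewrite !inE => /orP[] /eqP ->; exact: near0.
  have := Ar (M (ddiff (f \o eta) [:: t; t'])) _.
  move=> [|b Bb e]; first by exists (ddiff (f \o eta) [:: t; t']) => //; exists [:: t; t'].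
  have -> : (M \o f) (eta t') - (M \o f) (eta t) = (t' - t) *: M (ddiff (f \o eta) [:: t; t']).
    by rewrite /= /dquot linearZ scalerA divff ?subr_eq0// scale1r linearB.
  rewrite e scalerA; apply: (@dilation_le _ _ _ dB ((t' - t) * r)); last by exists b.
  by rewrite !normrM normr_id mulrC.
(* points will move by at most [3 q], half of the room left inside [y0 + 2 B] *)
pose q := (2 - s) / 6; have q0 : 0 < q by rewrite /q; lra.
pose d := Num.min 1 (q / r).
have d0 : 0 < d by rewrite lt_min ltr01 divr_gt0.
have d1 t : interval_around t0 d t -> interval_around t0 1 t.
  by rewrite /interval_around /= => /le_trans; apply; rewrite ge_min lexx.
have in_s t : interval_around t0 d t -> dilation (s + 3 * q) B (eta t - y0).
  move=> td; have Bg : dilation q B ((M \o f) (eta t) - (M \o f) (eta t0)).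
    have t01 : interval_around t0 1 t0 by rewrite /interval_around /= subrr normr0.
    apply: (dilation_ge0_le dB) (gB _ _ t01 (d1 _ td)).
      by rewrite mulr_ge0// ltW.
    rewrite mulrC -ler_pdivlMr//; apply: le_trans td _.
    by rewrite ge_min lexx orbT.
  have [|y yx gy] := solve hausE lcE genBB contr BBB s0 q0 _ Bx Bg.
    by rewrite /q; lra.
  have By : dilation (s + 3 * q) B (y - y0).
    rewrite -(subrKA (eta t0)) addrC; apply: (dilationD dB) => //; lra.
  have Uy : tame_domain BB y0 y.
    by exists B, (s + 3 * q); split => //; rewrite /q; lra.
  by rewrite -(tame_domain_inj hausE genBB contr Uy (eta_dom t) gy).
exists B, (s + 3 * q), d, (3 * r); split => //.
- by apply/andP; split; rewrite /q; lra.
- lra.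
split=> // t t' td td'; have [->|tt] := eqVneq t' t.
  by rewrite !subrr; exact: dilation0.
have q2 : s + 3 * q <= 2 by rewrite /q; lra.
have q2' : 0 <= s + 3 * q by rewrite /q; lra.
rewrite -mulrA; apply: (expanding genBB contr BBB).
- by rewrite mulr_gt0// normr_gt0 subr_eq0.
- exact: (dilation_ge0_le dB q2' q2 (in_s _ td)).
- exact: (dilation_ge0_le dB q2' q2 (in_s _ td')).
- by apply: gB; exact: d1.
Qed.

Lemma eta_ddiff0_bounded : locally_ddiff_bounded 0 eta.
Proof.
apply: ddiff_bounded_from_local; first by left.
move=> t0; have [B [s [d [K [BBB s2 d0 K0 [Bs _]]]]]] := eta_local t0.
have [dB _ bB] := generator_disk genBB BBB.
exists d => //; apply: (@vboundedS _ _ _ _ _ (vboundedD (vbounded_dilation s bB) (vbounded1 y0))).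
move=> _ [[|t [|? ?]] [_ sT TJ] ->] //; exists (eta t - y0), y0; split => //; last by rewrite subrK.
by apply: Bs; apply: TJ; exact: mem_head.
Qed.

(** Let [p] be the Newton polynomial of [eta] on [T] and [q] the product of the [t - u]
    for [u] in [T]. Then [eta t - p t] is [q] times the divided difference of [eta] on
    [t :: T], and the divided differences of [f \o eta] and [f \o p] on [t :: T] differ
    by [f (eta t) - f (p t)] divided by [q]. As [M \o f] is expanding, a bound for the
    latter quotients is one for the former divided differences. Bounds for [f \o p]
    come from smooth test curves if the nodes are close to each other, and from the
    order [m] otherwise. *)
Lemma eta_step m :
  (forall c, smooth_curve c -> (forall t, D (c t)) -> locally_ddiff_bounded m.+1 (f \o c)) ->
  (forall i, (i <= m)%N -> locally_ddiff_bounded i eta) -> locally_ddiff_bounded m.+1 eta.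
Proof.
move=> f_bounded eta_bounded.
apply: ddiff_bounded_from_local; first by right; exact: eta_bounded.
move=> t0; have [B0 [s0 [d0 [K0 [BBB0 /andP[s00 s02] d00 K00 [Bs0 BK0]]]]]] := eta_local t0.
have [B [r1 [BBB BC r10 Ar]]] := generator_enlarge genBB BBB0
  (ddiff_bounded_upto (fun i im => eta_bounded i im (`|t0| + d0))).
have [dB clB bB] := generator_disk genBB BBB.
pose K := K0 + r1; have K1 : 0 < K by exact: addr_gt0.
(* the last bound keeps Newton polynomials with nodes near [t0] inside [y0 + 2 B] *)
pose d := Num.min (Num.min d0 (1 / 2)) ((2 - s0) / (2 * m.+1%:R * K)).
have d1 : 0 < d by rewrite !lt_min d00 !divr_gt0 ?mulr_gt0//; lra.
have dd0 : d <= d0 by rewrite !ge_min lexx.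
have d2 : 2 * d <= 1.
  have : d <= 1 / 2 by rewrite !ge_min lexx orbT.
  by lra.
have dK : m%:R * (2 * d * K) <= 2 - s0.
  have : d <= (2 - s0) / (2 * m.+1%:R * K) by rewrite !ge_min lexx !orbT.
  rewrite ler_pdivlMr ?mulr_gt0//; apply: le_trans.
  have -> : d * (2 * m.+1%:R * K) = m.+1%:R * (2 * d * K) by ring.
  by rewrite ler_wpM2r ?ler_nat// !mulr_ge0// ltW.
have Jd0 t : interval_around t0 d t -> interval_around t0 d0 t.
  by rewrite /interval_around /= => /le_trans; apply.
have JN t : interval_around t0 d t -> segment_ball (`|t0| + d0) t.
  rewrite /segment_ball /= => /Jd0; rewrite /interval_around /= => tt.
  by rewrite -(subrK t0 t) addrC (le_trans (ler_normD _ _))// lerD2l.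
have etas t : interval_around t0 d t -> dilation s0 B (eta t - y0).
  by move=> /Jd0 /Bs0; apply: dilationS.
have etaK t t' : interval_around t0 d t -> interval_around t0 d t' ->
    dilation (K * `|t' - t|) B (eta t' - eta t).
  move=> /Jd0 td /Jd0 td'; apply: (dilation_ge0_le dB) (dilationS BC (BK0 _ _ td td')).
    by rewrite mulr_ge0// ltW.
  by rewrite ler_wpM2r// /K lerDl ltW.
have ddr i T : (i <= m)%N -> nodes (interval_around t0 d) i T -> dilation r1 B (ddiff eta T).
  by move=> im nT; apply: Ar; exists i, T; split => //; exact: nodesS nT.
have ddK i T : (i <= m)%N -> nodes (interval_around t0 d) i T -> dilation K B (ddiff eta T).
  move=> im nT; apply: (dilation_ge0_le dB) (ddr i T im nT); first exact: ltW.
  by rewrite /K lerDr ltW.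
have JJ t t' : interval_around t0 d t -> interval_around t0 d t' -> `|t - t'| <= 2 * d.
  rewrite /interval_around /= => td td'.
  by rewrite -(subrKA t0) (le_trans (ler_normD _ _))// [`|t0 - _|]distrC; lra.
have newton2 t T : nodes (interval_around t0 d) m.+1 (t :: T) ->
    dilation 2 B (newton eta T t - y0).
  case: T => [|a T] [uT sT TJ] //.
  have {}sT : size T = m by case: sT.
  have aJ : interval_around t0 d a by apply: TJ; rewrite !inE eqxx orbT.
  rewrite -(subrKA (eta a)).
  have -> : 2 = (2 - s0) + s0 :> R by ring.
  apply: (dilationD dB) => //; [lra| |exact: etas].
  apply: (dilation_ge0_le dB) dK _; first by rewrite !mulr_ge0// ltW.
  rewrite -sT; apply: newton_near_head => //; try exact: ltW.
  - by rewrite mulr_ge0// ltW.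
  - by move=> v vT; apply: JJ; apply: TJ; rewrite ?mem_head// inE vT orbT.
  - move=> i iT; apply: (ddK i.+1); first by rewrite -sT.
    have eq := cat_take_drop i.+2 (a :: T).
    split; [|by rewrite size_takel// ltnS |].
      have uaT : uniq (a :: T) by case/andP: uT.
      by move: uaT; rewrite -{1}eq cat_uniq => /and3P[].
    by move=> v /mem_take vT; apply: TJ; rewrite inE vT orbT.
have eta2 t : interval_around t0 d t -> dilation 2 B (eta t - y0).
  by move=> td; apply: (dilation_ge0_le dB s00 (ltW s02)); exact: etas.
pose F T := ddiff (f \o newton eta (behead T)) T.
have bF : vbounded [set x | exists2 T, nodes (interval_around t0 d) m.+1 T & x = F T].
  apply/vboundedP => W dW.
  suff [r r0 rW] : exists2 r : R, 0 < r & forall T, nodes (interval_around t0 d) m.+1 T ->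
      dilation r W (F T) by exists r => // _ [T nT ->]; exact: rW.
  apply: (nodes_uniform_bound (F := F)) => // [s sJ|rho rho0].
  - apply: (newton_ddiff_near hausE f_bounded (c := eta) (B := B) (K := K) (kappa := 2 - s0)) => //.
    + lra.
    + move=> x xs; apply: (BB_dom BBB); rewrite -(subrKA (eta s)).
      by have -> : 2 = (2 - s0) + s0 :> R; [ring|apply: (dilationD dB) => //; [lra|exact: etas]].
    + by move=> t tJ; exact: etaK.
    + by move=> t tJ; apply: le_trans (JJ _ _ tJ sJ) d2.
  - have [r2 r20 r2W] := (ddiff_boundedP _ _ _).1 (feta_bounded m.+1 (`|t0| + d0)) W dW.
    have [r3 r30 LW] := (vboundedP _).1 (vbounded_linear contL bB) W dW.
    have lam0 : 0 <= rho^-1 * (r1 + r1) by rewrite mulr_ge0 ?invr_ge0 ?addr_ge0// ltW.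
    exists (r2 + 2 * (rho^-1 * (r1 + r1)) * r3) => T nT [u [v [uT vT uv]]].
    have Bd := ddiff_far dB (ltW r10) rho0 (fun S nS => ddr m S (leqnn m) nS) nT uT vT uv.
    case: T nT {uT vT uv} Bd => [|t T] nT Bd; first by case: nT.
    have uT : uniq (t :: T) by case: nT.
    have tJ : interval_around t0 d t by case: nT => _ _; apply; exact: mem_head.
    set q := \prod_(u <- T) (t - u).
    have q0 : q != 0 by exact: prod_nodes_neq0.
    have Bq : dilation (`|q| * (rho^-1 * (r1 + r1))) B (eta t - newton eta T t).
      have pT : perm_eq (t :: T) (rcons T t) by rewrite perm_sym perm_rcons.
      rewrite newton_error -?(perm_uniq pT)// -(ddiff_perm _ uT pT) -/q.
      apply: (dilation_le dB) (dilationZ q Bd).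
      by rewrite !normrM normr_id.
    have [b Bb gb] := lipschitz genBB contr BBB (mulr_ge0 (normr_ge0 q) lam0) (newton2 _ _ nT) (eta2 _ tJ) Bq.
    have [w Ww Lb] := LW (L b) (ex_intro2 _ _ b Bb erefl).
    have -> : F (t :: T) = ddiff (f \o eta) (t :: T) -
        q^-1 *: (f (eta t) - f (newton eta T t)).
      by rewrite -(newton_node_error f eta uT) opprB addrC subrK.
    apply: (dilationB dW.1); [exact: ltW| |apply: r2W; exact: nodesS nT|].
      by apply: mulr_ge0; [exact: mulr_ge0|exact: ltW].
    rewrite -(MK (f (eta t))) -(MK (f (newton _ _ _))) -linearB gb linearZ Lb !scalerA.
    apply: (@dilation_le _ _ _ dW.1 (q^-1 * (2 * (`|q| * (rho^-1 * (r1 + r1)))) * r3)); last by exists w.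
    rewrite !normrM normr_id normfV.
    rewrite le_eqVlt; apply/orP; left; apply/eqP; field.
    by rewrite normr_eq0 q0.
have bdiff := vbounded_linear contM (vboundedD (feta_bounded m.+1 (`|t0| + d0)) (vbounded_dilation (-1) bF)).
have [B' [r5 [BBB' BB' r50 Br5]]] := generator_enlarge genBB BBB bdiff.
have [dB' _ bB'] := generator_disk genBB BBB'.
exists d => //; apply: (vboundedS _ (vbounded_dilation (3 * r5) bB')).
move=> _ [[|t T] nT ->]; first by case: nT.
have uT : uniq (t :: T) by case: nT.
have tJ : interval_around t0 d t by case: nT => _ _; apply; exact: mem_head.
set q := \prod_(u <- T) (t - u).
have q0 : q != 0 by exact: prod_nodes_neq0.
have qp : 0 < `|q| by rewrite normr_gt0.
have B'2 x : dilation 2 B x -> dilation 2 B' x by exact: dilationS.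
have Bg : dilation (`|q| * r5) B' ((M \o f) (eta t) - (M \o f) (newton eta T t)).
  have : dilation r5 B' (M (ddiff (f \o eta) (t :: T) - F (t :: T))).
    apply: Br5; exists (ddiff (f \o eta) (t :: T) - F (t :: T)) => //.
    exists (ddiff (f \o eta) (t :: T)), (- F (t :: T)); split => //.
      by exists (t :: T) => //; exact: nodesS nT.
    by exists (F (t :: T)); [exists (t :: T)|rewrite scaleN1r].
  rewrite (newton_node_error f eta uT) -/q linearZ linearB => /(dilationZ q).
  rewrite scalerA divff// scale1r; apply: (dilation_le dB').
  by rewrite !normrM normr_id.
have := expanding genBB contr BBB' (mulr_gt0 qp r50) (B'2 _ (newton2 _ _ nT)) (B'2 _ (eta2 _ tJ)) Bg.
have pT : perm_eq (t :: T) (rcons T t) by rewrite perm_sym perm_rcons.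
rewrite newton_error -?(perm_uniq pT)// -(ddiff_perm _ uT pT) -/q => /(dilationZ q^-1).
rewrite scalerA mulVf// scale1r; apply: (dilation_le dB').
rewrite !normrM normr_id normfV le_eqVlt; apply/orP; left; apply/eqP; field.
by rewrite normr_eq0.
Qed.

End InverseCurve.

(** * Tameness yields a contraction *)

Section TameContraction.
Variables (R : realType) (E : tvsType R).
Implicit Types (B : set E) (f : E -> E) (x v w : E).

Lemma gateaux_has_deriv D f x w u : gateaux_differentiable D f -> D (x + u *: w) ->
  has_deriv (fun s => f (x + s *: w)) u (gateaux_derive f (x + u *: w) w).
Proof.
move=> gf Dx; have [_ cf _ _] := gf _ Dx; apply/has_derivP.
have -> : curve_quotient (fun s => f (x + s *: w)) u = gateaux_quotient f (x + u *: w) w.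
  apply/funext => h; rewrite /curve_quotient /gateaux_quotient.
  by rewrite scalerDl [h *: w + _]addrC addrA.
have [l cl] := cf w.
exact: (@xgetPex _ 0 [set l | _ --> l]) (ex_intro _ l cl).
Qed.

(** By assumption the derivative of [M \o f - id] maps [B] into its half at all points of
    [y0 + 2 B], which contains the segment from [x] to [x']. *)
Lemma coloA_half_contraction D f (y0 : E) (BB : set (set E)) (M : {linear E -> E}) :
  continuous M -> cancel (gateaux_derive f y0) M -> coloA D f y0 2^-1 BB ->
  half_contraction BB y0 (M \o f).
Proof.
move=> cM LM [_ gf _ genBB col] B x x' r BBB r0 Bx Bx' Bw.
have [dB clB bB] := generator_disk genBB BBB.
set w := x' - x in Bw *.
have [r00|rn0] := eqVneq r 0.
  have w0 : w = 0 by case: Bw => b _ ->; rewrite r00 scale0r.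
  have -> : x' = x by apply/eqP; rewrite -subr_eq0 -/w w0.
  by rewrite subrr w0 subr0; exact: dilation0.
have rp : 0 < r by rewrite lt_def rn0.
have r2 : 0 < r / 2 by rewrite divr_gt0.
pose c u := (M \o (fun s => f (x + s *: w))) u + u *: (- w).
have := mean_value (c := c) (C := dilation (r / 2) B) (@ltr01 R) _ _ _.
rewrite subr0 invr1 scale1r /c /= !scale1r !scale0r addr0 addr0.
have -> : x + w = x' by rewrite /w addrC subrK.
rewrite addrAC; apply.
- exact: closed_dilation.
- by apply: disk_convex; exact: disk_dilation.
move=> u /andP[u0 u1].
have Bz : dilation 2 B (x + u *: w - y0).
  have -> : x + u *: w - y0 = u *: (x' - y0) + (1 - u) *: (x - y0).
    by rewrite scalerBl scale1r [RHS]addrCA -scalerBr opprB subrKA [RHS]addrAC.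
  exact: (disk_convex (disk_dilation dB 2)).
have [v Bv ev] := Bz.
have ez : x + u *: w = y0 + 2 *: v by rewrite -ev [RHS]addrC subrK.
have [Dz _ hz] := col B v BBB Bv.
have Dz' : D (x + u *: w) by rewrite ez.
exists (M (gateaux_derive f (x + u *: w) w) - w); last first.
  apply: has_derivD.
    by apply: has_deriv_linear => //; [move=> a b1 b2; rewrite linearP|exact: gateaux_has_deriv gf Dz'].
  by have := has_deriv_scalar (- w) (@is_derive_id R R u 1); rewrite scale1r.
have [_ _ lin _] := gf _ Dz'.
have [G eG] := linear_bundle lin.
have [b Bb ewb] := Bw.
have [b' Bb' eb] := hz _ (ex_intro2 _ _ b Bb erefl).
exists b' => //.
have := congr1 M eb; rewrite -ez eG linearZ /= LM linearB LM => eM.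
by rewrite ewb 2!linearZ /= -scalerBr -eM scalerA.
Qed.

End TameContraction.

Theorem theorem8 (R : realType) (E : tvsType R) (hausE : hausdorff_space E)
    (k : lip_order) (hk : k <> FiniteOrder 0%N)
    (D : set E) (f : E -> E) (y0 : E)
    (flip : lipFK k D f) (ftame : colombeau0_tame D f y0) :
  exists U : set E,
    [/\ U y0, mopen U, set_inj (U `&` D) f &
        lipFK k (f @` (U `&` D)) ('pinv_(fun=> 0) (U `&` D) f)].
Proof.
have [[bornE lcE] _ _ flipc] := flip.
have [BB [col [linL contL [M0 [contM LM ML]]]]] := ftame setT openT I.
rewrite setTI in col.
have [_ gf _ genBB colB] := col.
have [L eL] := linear_bundle linL.
have linM : linear M0.
  by move=> a x y; apply: (can_inj LM); rewrite eL linearP -eL !ML.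
have [M eM] := linear_bundle linM.
have {linM} contr : half_contraction BB y0 (M \o f).
  by apply: coloA_half_contraction col; rewrite -?eM.
have domD B x : BB B -> dilation 2 B (x - y0) -> D x.
  move=> BBB [v Bv e]; have [Dv _ _] := colB B v BBB Bv.
  by have -> : x = y0 + 2 *: v by rewrite -e [RHS]addrC subrK.
pose U := tame_domain BB y0.
have UD : U `&` D = U.
  apply/seteqP; split=> [x []//|x Ux]; split=> //.
  have [B [s [BBB s0 s2 Bx]]] := Ux; apply: (domD B) => //.
  have [dB _ _] := generator_disk genBB BBB.
  exact: (dilation_ge0_le dB s0 (ltW s2)).
have injU : set_inj U f.
  move=> x x' /set_mem Ux /set_mem Ux' e.
  by apply: (tame_domain_inj hausE genBB contr Ux Ux'); rewrite /= e.
have MK : cancel M L by move=> x; rewrite -eL -eM ML.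
exists U; rewrite UD; split => //.
- exact: tame_domain_center.
- exact: mopen_tame_domain.
split => //.
  move=> _ A [x Ux <-] bA.
  have bMA : vbounded (M @` A) by apply: vbounded_linear => //; rewrite -eM.
  have [d d0 sol] := tame_domain_solve hausE lcE genBB contr Ux bMA.
  exists d => // t td a Aa.
  have [y Uy gy] := sol t td _ (ex_intro2 _ _ a Aa erefl).
  exists y => //; apply: (can_inj MK).
  by rewrite linearD linearZ -gy.
move=> c sc cU.
pose eta := 'pinv_(fun=> 0) U f \o c.
have etaP t : U (eta t) /\ f (eta t) = c t.
  have [x Ux e] := cU t; rewrite /eta /= -e.
  by rewrite pinvKV ?inE//; exact/injU.
have feta : f \o eta = c by apply/funext => t; exact: (etaP t).2.
have etaU t : U (eta t) by exact: (etaP t).1.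
have contL' : continuous L by rewrite -eL.
have contM' : continuous M by rewrite -eM.
have bfeta m : locally_ddiff_bounded m (f \o eta).
  by rewrite feta; exact: smooth_ddiff_bounded.
have eta_lipn n : (forall b, smooth_curve b -> (forall t, D (b t)) -> lipn_curve n (f \o b)) ->
    lipn_curve n eta.
  move=> fn; apply: ddiff_bounded_lipn => // m /andP[_ mn].
  have upto j : (j <= n.+1)%N -> forall i, (i <= j)%N -> locally_ddiff_bounded i eta.
    elim: j => [_ i|j IH jn i].
      rewrite leqn0 => /eqP ->.
      exact: (eta_ddiff0_bounded hausE lcE genBB contM' contr etaU bfeta).
    rewrite leq_eqVlt => /orP[/eqP ->|]; last exact: IH (ltnW jn) i.
    apply: (eta_step hausE lcE genBB contL' contM' MK contr domD etaU bfeta) => [b sb bD|i' ij].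
      exact: lipn_ddiff_bounded (fn b sb bD) jn.
    exact: IH (ltnW jn) i' ij.
  exact: upto mn m (leqnn m).
case: k {hk flip} flipc => [n|] flipc /=; first by apply: eta_lipn => b; exact: flipc.
by move=> n; apply: eta_lipn => b sb bD; exact: flipc.
Qed.
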